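(* Let $W(t)$, $t\in\mathbb{R}$, be a Gaussian process with almost surely continuous sample paths, continuous mean function $m(t)$ and continuous covariance kernel $\Sigma_{t_1,t_2}$, and assume $\Sigma_{t,s}>0$ for all $s,t\in\mathbb{R}$. Let $\gamma\in\mathbb{R}$ be a constant, $\Phi$ the standard normal cdf, and $$Q(t,W(\cdot))=\int_0^t\Phi(W(y))\,dy-t\gamma .$$ Then the argmin of $Q(t,W(\cdot))$ over $t\in\mathbb{R}$ is unique almost surely (it contains at most one point with probability one).
   Context: $\Phi$ denotes the standard normal cumulative distribution function. *)

(* Defs.v *)
From HB Require Import structures.
From mathcomp Require Import all_boot all_order all_algebra.
From mathcomp Require Import all_classical all_reals all_analysis.
Set Implicit Arguments. Unset Strict Implicit. Unset Printing Implicit Defensive.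
Import Order.TTheory GRing.Theory Num.Theory.
Import numFieldNormedType.Exports.
Local Open Scope classical_set_scope.
Local Open Scope ring_scope.

Definition Phi {R : realType} (x : R) : R := fine (normal_prob 0 1 `]-oo, x]).

(* Law of a (possibly degenerate) Gaussian with mean mu and variance v:
   the Dirac mass at mu if v = 0, else N(mu, v) (normal_prob takes the
   standard deviation). *)
Definition gaussian_law {R : realType} (mu v : R) : set R -> \bar R :=
  if v == 0 then \d_mu else normal_prob mu (Num.sqrt v).

Definition has_gaussian_law {d} {T : measurableType d} {R : realType}
  (P : probability T R) (X : T -> R) (mu v : R) : Prop :=
  forall A : set R, measurable A -> P (X @^-1` A) = gaussian_law mu v A.

Definition gaussian_process {d} {T : measurableType d} {R : realType}
  (P : probability T R) (W : R -> T -> R) (m : R -> R) (Sig : R -> R -> R)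
  : Prop :=
  (forall t, measurable_fun [set: T] (W t)) /\
  forall (n : nat) (ts : 'I_n -> R) (a : 'I_n -> R),
    has_gaussian_law P (fun w => \sum_(i < n) a i * W (ts i) w)
      (\sum_(i < n) a i * m (ts i))
      (\sum_(i < n) \sum_(j < n) a i * a j * Sig (ts i) (ts j)).

Definition oint0 {R : realType} (f : R -> R) (t : R) : R :=
  if 0 <= t then Rintegral (@lebesgue_measure R) `[0, t] f
  else - Rintegral (@lebesgue_measure R) `[t, 0] f.

Definition Qfun {R : realType} (gamma : R) (w : R -> R) (t : R) : R :=
  oint0 (fun y => Phi (w y)) t - t * gamma.

Definition argmin {R : realType} (f : R -> R) : set R :=
  [set t | forall s, f t <= f s].

(* Main.v *)
(** Write W(t) = m(t) + h(t) Z + Y(t) with Z = W(0) - m(0), h(t) = Sig(t,0)/Sig(0,0) > 0 (see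
    [regression] for an asymmetric Sig) and Y independent of Z, and freeze Y.  Since Phi is
    strictly increasing, raising the value of Z adds a strictly increasing function of t to Q(t).
    Hence, for a given rational b, there is at most one value of Z for which Q attains its minimum
    both on ]-oo, b[ and on ]b, +oo[: below it the infimum over ]b, +oo[ is the smaller one, above
    it the infimum over ]-oo, b].  As Z is independent of Y and has no atoms, this value is almost
    surely missed.  Independence of Z and Y is derived from the characteristic functions of the
    linear combinations, by smoothing with Gaussian densities of small variance. *)
Require Import Defs.
From HB Require Import structures.
From mathcomp Require Import all_boot all_order all_algebra.
From mathcomp Require Import all_classical all_reals all_analysis.
From mathcomp Require Import measurable_realfun ring lra.
Set Implicit Arguments. Unset Strict Implicit. Unset Printing Implicit Defensive.
Import Order.TTheory GRing.Theory Num.Theory.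
Import numFieldNormedType.Exports.
Local Open Scope classical_set_scope.
Local Open Scope ring_scope.

(** The critical value of Z, as a function of Y, is never constructed, so its measurability never
    has to be settled. Instead [-M, +oo[ is cut into cells of length e / C, where C bounds the
    density of Z. A double minimum with Z inside the k-th cell forces an event [H k] that depends on
    Y alone. These events are pairwise disjoint, since the critical value lies in one cell only, and
    independence bounds the total probability by the sum of e P([H k]), hence by e. Characteristic
    functions appear as integrals of cos(aX + c): the free phase c makes real cosines carry the same
    information as complex exponentials, and products are turned back into cosines by the
    product-to-sum formula. Continuity of the paths is known only off a null set N. Multiplying Z
    and Y by the indicator of the complement of N makes every path continuous while preserving all
    the integrals that matter; only then do the events about infima belong to the sigma-algebra
    generated by Y, which need not contain N. *)

Lemma integrable_bounded d (T : measurableType d) (R : realType)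
    (mu : {finite_measure set T -> \bar R}) (D : set T) (f : T -> R) (C : R) :
  measurable D -> measurable_fun D f -> (forall x, D x -> `|f x| <= C) ->
  mu.-integrable D (EFin \o f).
Proof.
move=> mD mf fC; apply: measurable_bounded_integrable => //.
  by rewrite ltey_eq fin_num_measure.
exists C; split=> [|M CM x Dx]; [exact: num_real|exact: le_trans (fC x Dx) (ltW CM)].
Qed.

(** * The characteristic function of the normal law *)

(** The constant 3/8 is 1/2 - 1/8, the difference of the Gaussian exponents at scales [s] and
    [2 * s]. Passing to the wider density leaves this spare decay, which later absorbs a linear
    factor and gives tail bounds without computing a tail integral. *)
Lemma normal_pdf_double (R : realType) (m s x : R) : 0 < s ->
  normal_pdf m s x = 2 * expR (- (3 / 8 * ((x - m) / s) ^+ 2)) * normal_pdf m (2 * s) x.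
Proof.
move=> s0; have s1 : s != 0 by rewrite gt_eqF.
have s2 : 2 * s != 0 by rewrite mulf_neq0.
rewrite !normal_pdfE // /normal_fun.
have -> : normal_peak s = 2 * normal_peak (2 * s).
  rewrite /normal_peak.
  have -> : (2 * s) ^+ 2 * pi *+ 2 = 2 ^+ 2 * (s ^+ 2 * pi *+ 2) :> R by rewrite exprMn; ring.
  rewrite sqrtrM ?sqr_ge0 // sqrtr_sqr ger0_norm // invfM mulrA divff ?mul1r //.
rewrite -!mulrA; congr (_ * _); rewrite mulrCA; congr (_ * _).
by rewrite -expRD; congr expR; field.
Qed.

Lemma is_derive_normal_pdf (R : realType) (m s x : R) : s != 0 ->
  is_derive x 1 (normal_pdf m s) (- (x - m) / s ^+ 2 * normal_pdf m s x).
Proof.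
move=> s0; rewrite normal_pdfE // /normal_fun.
apply: is_derive_eq.
rewrite scaler0 add0r subr0 /GRing.scale /= mulr1.
by field.
Qed.

(** The fundamental theorem of calculus on [-(n+1), n+1], an interval that is never degenerate,
    followed by dominated convergence with the norm of [h] as bound. This plays the role of
    integration by parts over the whole line. *)
Lemma integral_derive_eq0 (R : realType) (H h : R -> R) :
  (forall x : R, is_derive x 1 H (h x)) -> continuous h ->
  (@lebesgue_measure R).-integrable setT (EFin \o h) ->
  H n.+1%:R @[n --> \oo] --> 0 -> H (- n.+1%:R) @[n --> \oo] --> 0 ->
  \int[lebesgue_measure]_x h x = 0.
Proof.
move=> dH ch ih Hp Hm.
have mh : measurable_fun setT h by exact: continuous_measurable_fun.
pose D (n : nat) : set R := `[- n.+1%:R, n.+1%:R]%classic.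
have cvg1 : (\int[lebesgue_measure]_x ((h \_ (D n)) x)%:E @[n --> \oo] -->
  \int[lebesgue_measure]_x (h x)%:E)%E.
  apply: (@dominated_cvg _ _ _ (@lebesgue_measure R) setT measurableT
    (fun n => EFin \o (h \_ (D n))) (EFin \o h) (abse \o (EFin \o h))) => //.
  - move=> n; apply/measurable_EFinP/(measurable_restrictT _ _).1.
      exact: measurable_itv.
    exact: measurable_funTS.
  - move=> x _; apply: cvg_near_cst; near=> n => /=.
    rewrite patchE mem_set // /D /= in_itv /= -ler_norml.
    apply: ltW; apply: lt_le_trans (_ : n%:R <= _); last by rewrite ler_nat.
    near: n; exact: nbhs_infty_gtr.
  - exact: integrable_abse.
  - move=> n x _ /=; rewrite lee_fin patchE; case: ifP => // _.
    by rewrite normr0.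
have E n : (\int[lebesgue_measure]_x ((h \_ (D n)) x)%:E = (H n.+1%:R - H (- n.+1%:R))%:E)%E.
  transitivity (\int[lebesgue_measure]_(x in D n) (h x)%:E)%E.
    rewrite [RHS]integral_mkcond; apply: eq_integral => x _.
    by rewrite restrict_EFin.
  rewrite /D (@continuous_FTC2 _ h H) //.
  - by rewrite -subr_gt0 opprK addr_gt0.
  - exact: continuous_subspaceT.
  - have cH x : {for x, continuous H}.
      by apply/differentiable_continuous/derivable1_diffP; case: (dH x).
    split; [by move=> x _; case: (dH x)| |].
    + exact/cvg_at_right_filter/cH.
    + exact/cvg_at_left_filter/cH.
  - by move=> x _; rewrite derive1E; exact: derive_val.
have cvg2 : ((H n.+1%:R - H (- n.+1%:R))%:E @[n --> \oo] --> (0 - 0 : R)%:E)%E.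
  by apply: cvg_EFin; [exact: nearW|apply: cvgB].
rewrite subrr in cvg2.
rewrite (_ : (fun n => _) = (fun n => \int[lebesgue_measure]_x ((h \_ (D n)) x)%:E)%E) in cvg2; last first.
  by apply/funext => n; rewrite E.
by rewrite /Rintegral -(cvg_unique (@ereal_hausdorff R) cvg2 cvg1).
Unshelve. all: by end_near. Qed.

(** With y = |x - m| / s the claim reduces to y <= 2 exp(3/8 y^2), which follows from exp u >= 1 + u
    and y <= 2 + 3/4 y^2. *)
Lemma norm_normal_pdf_le (R : realType) (m s x : R) : 0 < s ->
  `|x - m| * normal_pdf m s x <= 4 * s * normal_pdf m (2 * s) x.
Proof.
move=> s0; rewrite normal_pdf_double // mulrA ler_wpM2r ?normal_pdf_ge0 //.
set y := `|x - m| / s.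
have -> : ((x - m) / s) ^+ 2 = y ^+ 2.
  by rewrite /y !expr_div_n real_normK // num_real.
have -> : `|x - m| = y * s by rewrite /y divfK // gt_eqF.
have y0 : 0 <= y by rewrite divr_ge0 // ltW.
rewrite expRN.
have e0 := expR_gt0 (3 / 8 * y ^+ 2).
have e1 := expR_ge1Dx (3 / 8 * y ^+ 2).
rewrite mulrA ler_pdivrMr //.
have : y <= 2 * expR (3 / 8 * y ^+ 2) by nra.
by nra.
Qed.

Lemma integrable_norm_normal_pdf (R : realType) (m s : R) : 0 < s ->
  (@lebesgue_measure R).-integrable setT (EFin \o (fun x => `|x - m| * normal_pdf m s x)).
Proof.
move=> s0.
apply: (@le_integrable _ _ _ lebesgue_measure _ measurableT _ (fun x => (4 * s)%:E * (normal_pdf m (2 * s) x)%:E)%E).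
- apply/measurable_EFinP; apply: measurable_funM; last exact: measurable_normal_pdf.
  by apply: measurableT_comp => //; exact: measurable_funB.
- move=> x _ /=; rewrite lee_fin ger0_norm; last by rewrite mulr_ge0 ?normal_pdf_ge0.
  exact: le_trans (norm_normal_pdf_le _ x s0) (ler_norm _).
- by apply: integrableZl => //; exact: integrable_normal_pdf.
Qed.

Lemma cos_abs_le1 (R : realType) (x : R) : `|cos x| <= 1.
Proof. by rewrite ler_norml cos_geN1 cos_le1. Qed.

Lemma sin_abs_le1 (R : realType) (x : R) : `|sin x| <= 1.
Proof. by rewrite ler_norml sin_geN1 sin_le1. Qed.

Lemma measurable_cos (R : realType) : measurable_fun setT (@cos R).
Proof. by apply: continuous_measurable_fun; exact: continuous_cos. Qed.

Lemma measurable_sin (R : realType) : measurable_fun setT (@sin R).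
Proof. by apply: continuous_measurable_fun; exact: continuous_sin. Qed.

Lemma integrable_mul_normal_pdf (R : realType) (m s C : R) (f : R -> R) :
  measurable_fun setT f -> (forall x, `|f x| <= C) ->
  (@lebesgue_measure R).-integrable setT (EFin \o (fun x => f x * normal_pdf m s x)).
Proof.
move=> mf fC.
apply: (@le_integrable _ _ _ lebesgue_measure _ measurableT _ (fun x => C%:E * (normal_pdf m s x)%:E)%E).
- by apply/measurable_EFinP; apply: measurable_funM => //; exact: measurable_normal_pdf.
- move=> x _ /=; rewrite lee_fin !normrM ler_wpM2r //; exact: le_trans (fC x) (ler_norm _).
- by apply: integrableZl => //; exact: integrable_normal_pdf.
Qed.

(** As a function [F] of the frequency, the integral solves F'(u) = - s^2 u F(u): differentiation
    under the integral sign produces a sine term, which Stein's identity converts back into [F].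
    Hence F(u) exp(s^2 u^2 / 2) is constant, with value cos c at u = 0. *)
Lemma integral_cos_normal_pdf (R : realType) (m s c t : R) : 0 < s ->
  \int[lebesgue_measure]_x (cos (t * (x - m) + c) * normal_pdf m s x) =
  cos c * expR (- (s ^+ 2 * t ^+ 2 / 2)).
Proof.
move=> s0; have sn0 : s != 0 by rewrite gt_eqF.
have maff (u : R) : measurable_fun setT (fun x : R => u * (x - m) + c).
  by apply: measurable_funD => //; apply: measurable_funM => //; exact: measurable_funB.
pose F (u : R) := \int[lebesgue_measure]_x (cos (u * (x - m) + c) * normal_pdf m s x).
have iC (u : R) : (@lebesgue_measure R).-integrable setT
    (EFin \o (fun x => cos (u * (x - m) + c) * normal_pdf m s x)).
  apply: (@integrable_mul_normal_pdf _ _ _ 1); last by move=> x; exact: cos_abs_le1.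
  exact: (measurableT_comp (@measurable_cos R) (maff u)).
have iS (u : R) : (@lebesgue_measure R).-integrable setT
    (EFin \o (fun x => (x - m) * sin (u * (x - m) + c) * normal_pdf m s x)).
  apply: (@le_integrable _ _ _ lebesgue_measure _ measurableT _ (fun x => (`|x - m| * normal_pdf m s x)%:E)); last exact: integrable_norm_normal_pdf.
    apply/measurable_EFinP; apply: measurable_funM; last exact: measurable_normal_pdf.
    apply: measurable_funM; first exact: measurable_funB.
    exact: (measurableT_comp (@measurable_sin R) (maff u)).
  move=> x _ /=; rewrite lee_fin !normrM normr_id -mulrA ler_wpM2l //.
  by rewrite ler_piMl // sin_abs_le1.
have dF (u : R) : is_derive u 1 F (- (\int[lebesgue_measure]_x ((x - m) * sin (u * (x - m) + c) * normal_pdf m s x))).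
  pose f (v x : R) := cos (v * (x - m) + c) * normal_pdf m s x.
  have df (v x : R) : is_derive v 1 (f^~ x) (- ((x - m) * sin (v * (x - m) + c) * normal_pdf m s x)).
    rewrite /f; apply: is_derive_eq.
    rewrite /GRing.scale /=; ring.
  have p1 : partial1of2 f = fun v x => - ((x - m) * sin (v * (x - m) + c) * normal_pdf m s x).
    by apply/funext => v; apply/funext => x; rewrite partial1of2E; exact: derive_val.
  have Iu : `]u - 1, u + 1[%classic u by rewrite /= in_itv /=; lra.
  have G0 (x : R) : 0 <= `|x - m| * normal_pdf m s x by rewrite mulr_ge0 ?normal_pdf_ge0.
  have Gub (v x : R) : `]u - 1, u + 1[%classic v -> setT x ->
      `|partial1of2 f v x| <= `|x - m| * normal_pdf m s x.
    move=> _ _; rewrite p1 normrN !normrM (ger0_norm (normal_pdf_ge0 _ _ _)).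
    by rewrite ler_wpM2r ?normal_pdf_ge0 // ler_piMr // sin_abs_le1.
  have Df (v x : R) : `]u - 1, u + 1[%classic v -> setT x -> derivable (f^~ x) v 1.
    by move=> _ _; case: (df v x).
  have dFu := @derivable_under_integral _ _ _ lebesgue_measure f _ measurableT _ _ _ Iu
    (fun v _ => iC v) Df _ G0 (integrable_norm_normal_pdf m s0) Gub.
  have vFu := @differentiation_under_integral _ _ _ lebesgue_measure f _ measurableT _ _ _ Iu
    (fun v _ => iC v) Df _ G0 (integrable_norm_normal_pdf m s0) Gub.
  apply: DeriveDef => //; rewrite -derive1E [LHS]vFu.
  rewrite p1 -[RHS]mulN1r -RintegralZl //.
  by apply: eq_Rintegral => x _; rewrite mulN1r.
have stein (u : R) : \int[lebesgue_measure]_x ((x - m) * sin (u * (x - m) + c) * normal_pdf m s x) = s ^+ 2 * u * F u.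
  pose H (x : R) := - s ^+ 2 * sin (u * (x - m) + c) * normal_pdf m s x.
  pose h (x : R) := (x - m) * sin (u * (x - m) + c) * normal_pdf m s x
    - s ^+ 2 * u * (cos (u * (x - m) + c) * normal_pdf m s x).
  have dH (x : R) : is_derive x 1 H (h x).
    have := is_derive_normal_pdf m x sn0.
    rewrite /H => ?; apply: is_derive_eq.
    by rewrite /GRing.scale /= /h; field.
  have cs : continuous (fun x : R => sin (u * (x - m) + c)).
    move=> x; apply: differentiable_continuous; exact/derivable1_diffP.
  have ch : continuous h.
    have cc : continuous (fun x : R => cos (u * (x - m) + c)).
      move=> x; apply: differentiable_continuous; exact/derivable1_diffP.
    have cp := @continuous_normal_pdf R m s sn0.
    move=> x; apply: cvgB.
      apply: cvgM; last exact: cp.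
      apply: cvgM; last exact: cs.
      by apply: cvgB => //; exact: cvg_cst.
    by apply: cvgM; [exact: cvg_cst|apply: cvgM; [exact: cc|exact: cp]].
  have ih : (@lebesgue_measure R).-integrable setT (EFin \o h).
    rewrite /comp /h; under eq_fun do rewrite EFinB.
    apply: integrableB => //; first exact: iS.
    by under eq_fun do rewrite EFinM; apply: integrableZl => //; exact: iC.
  (* A bound for |x| |H x|, so that [H] is O(1/|x|) and vanishes at both ends of the line. It comes
     from |x| <= |x - m| + |m|: the first term is absorbed by the density of deviation [2 * s], the
     second is multiplied by a density that is at most its peak. *)
  pose K := s ^+ 2 * (4 * s * normal_peak (2 * s) + `|m| * normal_peak s).
  have HK (x : R) : `|x| * `|H x| <= K.
    have p0 := normal_pdf_ge0 m s x.
    have p1 := normal_pdf_ub m x sn0.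
    have s20 : 2 * s != 0 by rewrite mulf_neq0.
    have p2 := normal_pdf_ub m x s20.
    have p3 := norm_normal_pdf_le m x s0.
    have xm : `|x| <= `|x - m| + `|m| by rewrite -{1}(subrK m x) ler_normD.
    have Hx : `|H x| <= s ^+ 2 * normal_pdf m s x.
      have sq : `|- s ^+ 2| = s ^+ 2 by rewrite normrN ger0_norm ?sqr_ge0.
      rewrite /H normrM (ger0_norm p0) normrM sq -mulrA.
      by rewrite ler_wpM2l ?sqr_ge0 // ler_piMl // sin_abs_le1.
    apply: (le_trans (ler_wpM2l (normr_ge0 x) Hx)).
    rewrite mulrCA ler_wpM2l ?sqr_ge0 //.
    apply: (le_trans (ler_wpM2r p0 xm)); rewrite mulrDl lerD //.
      by apply: (le_trans p3); rewrite ler_wpM2l // mulr_ge0 // ltW.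
    by rewrite ler_wpM2l.
  have H0 (e : nat -> R) : (forall n, `|e n| = n.+1%:R) -> H (e n) @[n --> \oo] --> 0.
    move=> en; apply: norm_cvg0.
    apply: (@squeeze_cvgr _ _ _ _ (fun=> 0) (fun n => K * harmonic n)).
    - near=> n; rewrite normr_ge0 /= /harmonic ler_pdivlMr // mulrC -en; exact: HK.
    - exact: cvg_cst.
    - rewrite -[X in _ --> X](mulr0 K); apply: cvgM; [exact: cvg_cst|exact: cvg_harmonic].
  have := integral_derive_eq0 dH ch ih (H0 _ _) (H0 _ _).
  rewrite /h RintegralB //; last first.
    by rewrite /comp; under eq_fun do rewrite EFinM; apply: integrableZl => //; exact: iC.
  rewrite RintegralZl //.
  move=> E; apply/eqP; rewrite -subr_eq0; apply/eqP; apply: E => n.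
    by rewrite ger0_norm.
  by rewrite normrN ger0_norm.
have F0 : F 0 = cos c.
  rewrite /F; under eq_Rintegral do rewrite mul0r add0r.
  rewrite RintegralZl //; last exact: integrable_normal_pdf.
  by rewrite /Rintegral integral_normal_pdf mulr1.
pose G u := F u * expR (s ^+ 2 * u ^+ 2 / 2).
have dG (u : R) : is_derive u 1 G 0.
  have := dF u; rewrite stein /G => ?; apply: is_derive_eq.
  by rewrite /GRing.scale /=; field.
have := @is_derive_0_is_cst _ _ t 0 dG.
rewrite /G F0 expr0n /= mulr0 mul0r expR0 mulr1 -/(F t) => <-.
by rewrite -(mulrA (F t)) -expRD subrr expR0 mulr1.
Unshelve. all: by end_near. Qed.

(** * Uniqueness from cosine integrals *)

Lemma Rintegral_indicM d (T : measurableType d) (R : realType)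
    (mu : {measure set T -> \bar R}) (A : set T) (f : T -> R) :
  \int[mu]_(x in A) f x = \int[mu]_x (f x * \1_A x).
Proof.
rewrite Rintegral_mkcond; apply: eq_Rintegral => x _.
by rewrite patchE indicE; case: (x \in A); rewrite ?mulr1 ?mulr0.
Qed.

(** Dynkin's pi-lambda argument for the signed measure sending A to the integral of [g] over A. The
    vanishing total mass is what gives stability under complement. *)
Lemma Rintegral_dynkin d (T : measurableType d) (R : realType)
    (mu : {measure set T -> \bar R}) (g : T -> R) (G : set (set T)) :
  mu.-integrable setT (EFin \o g) -> setI_closed G -> G `<=` measurable ->
  \int[mu]_x g x = 0 -> (forall A, G A -> \int[mu]_(x in A) g x = 0) ->
  forall A, <<s G >> A -> \int[mu]_(x in A) g x = 0.
Proof.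
move=> ig GI Gm g0 gG A sA.
have igA B : measurable B -> mu.-integrable B (EFin \o g).
  by move=> mB; apply: (integrableS measurableT mB).
suff : <<s G >> `<=` [set A | measurable A /\ \int[mu]_(x in A) g x = 0].
  by move=> /(_ _ sA)[].
apply: lambda_system_subset => //; last by move=> B GB; split; [exact: Gm|exact: gG].
apply/dynkin_lambda_system; split => //.
- move=> B [mB B0]; split; first exact: measurableC.
  have := @Rintegral_setU _ _ _ mu B (~` B) g mB (measurableC mB).
  rewrite setUCr g0 B0 add0r => <- //.
  by apply/disj_setPCl.
- move=> F tF mF0.
  have mF n : measurable (F n) by have [] := mF0 n.
  split; first exact: bigcup_measurable.
  rewrite /Rintegral integral_bigcup //; last exact/igA/bigcup_measurable.
  rewrite eseries0 // => n _ _ .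
  have [_] := mF0 n; rewrite /Rintegral => F0.
  by rewrite -[LHS]fineK ?F0 //; apply: integrable_fin_num => //; exact: igA.
Qed.

(** The order of integration is exchanged, and the integral over [P] is zero for each fixed [u].
    Integrability of every section keeps the inner integrals finite, so that [fine] loses
    nothing. *)
Lemma Rintegral_Fubini0 d d' (T : measurableType d) (U : measurableType d') (R : realType)
    (P : {sigma_finite_measure set T -> \bar R})
    (nu : {sigma_finite_measure set U -> \bar R}) (K : T * U -> R) :
  measurable_fun setT K ->
  (\int[P]_w \int[nu]_u `|K (w, u)|%:E < +oo)%E ->
  (forall w, nu.-integrable setT (fun u => (K (w, u))%:E)) ->
  (forall u, P.-integrable setT (fun w => (K (w, u))%:E)) ->
  (forall u, \int[P]_w K (w, u) = 0) ->
  \int[P]_w (\int[nu]_u K (w, u)) = 0.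
Proof.
move=> mK Kfin iK1 iK2 K0.
have mK' : measurable_fun setT (EFin \o K) by exact/measurable_EFinP.
have iK : (P \x nu)%E.-integrable setT (EFin \o K) by apply/integrable12ltyP.
rewrite /Rintegral.
transitivity (fine (\int[P]_w \int[nu]_u (EFin \o K) (w, u))%E).
  congr fine; apply: eq_integral => w _; rewrite fineK //.
  exact: integrable_fin_num.
rewrite (Fubini iK) integral0_eq // => u _.
have := K0 u; rewrite /Rintegral => /= E.
by rewrite -[LHS]fineK ?E //; exact: integrable_fin_num.
Qed.

Lemma normal_prob_fin_num (R : realType) (m s : R) (V : set R) :
  measurable V -> normal_prob m s V \is a fin_num.
Proof. by move=> mV; exact: (fin_num_measure (normal_prob m s)). Qed.

Lemma normal_prob_fineC (R : realType) (m s : R) (V : set R) : measurable V ->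
  fine (normal_prob m s V) = 1 - fine (normal_prob m s (~` V)).
Proof.
move=> mV; have := normal_prob_fin_num m s mV.
have : (normal_prob m s (~` V) = 1 - normal_prob m s V)%E.
  exact: (probability_setC (normal_prob m s) mV).
move: (normal_prob m s V) (normal_prob m s (~` V)) => [p| |] // q -> _ /=.
by rewrite subKr.
Qed.

(** Allows a smoothing kernel centred at the random point to be read as a fixed density evaluated at
    that point. *)
Lemma normal_pdf_sym (R : realType) (m s x : R) : s != 0 -> normal_pdf m s x = normal_pdf x s m.
Proof. by move=> s0; rewrite !normal_pdfE // /normal_fun -(opprB x m) sqrrN. Qed.

Lemma measurable_normal_pdf2 d (T : measurableType d) (R : realType) (s : R) (m x : T -> R) :
  s != 0 -> measurable_fun setT m -> measurable_fun setT x ->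
  measurable_fun setT (fun z => normal_pdf (m z) s (x z)).
Proof.
move=> s0 mm mx; under eq_fun do rewrite normal_pdfE // /normal_fun.
apply: measurable_funM => //; apply: measurableT_comp => //.
apply: measurable_funM => //; apply: measurableT_comp => //.
by apply: measurable_funX; apply: measurable_funB.
Qed.

Lemma measurable_normal_prob_mean (R : realType) (s : R) (V : set R) : s != 0 -> measurable V ->
  measurable_fun setT (fun m => fine (normal_prob m s V)).
Proof.
move=> s0 mV; apply: measurableT_comp => //.
pose K (z : R * R) := (normal_pdf z.1 s z.2 * \1_V z.2)%:E.
have mK : measurable_fun setT K.
  apply/measurable_EFinP; apply: measurable_funM; first exact: measurable_normal_pdf2 s0 measurable_fst measurable_snd.
  by apply: measurableT_comp => //; exact: measurable_indic.
have K0 z : (0 <= K z)%E by rewrite lee_fin mulr_ge0 ?normal_pdf_ge0.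
have := @measurable_fun_fubini_tonelli_F _ _ _ _ _ (@lebesgue_measure R) K mK K0.
congr (measurable_fun _ _); apply/funext => m.
rewrite /fubini_F /normal_prob [RHS]integral_mkcond; apply: eq_integral => x _.
by rewrite /K patchE indicE; case: (x \in V); rewrite ?mulr1 ?mulr0.
Qed.

(** On [V] the spare factor of [normal_pdf_double] is at most [c], and what remains is the density
    of a probability. *)
Lemma normal_prob_tail (R : realType) (m s e : R) (V : set R) : 0 < s -> 0 <= e ->
  measurable V -> (forall u, V u -> e <= `|u - m|) ->
  fine (normal_prob m s V) <= 2 * expR (- (3 / 8 * (e / s) ^+ 2)).
Proof.
move=> s0 e0 mV Ve; set c := 2 * _.
have c0 : 0 <= c by rewrite mulr_ge0 ?expR_ge0.
have s2 : 2 * s != 0 by rewrite mulf_neq0 // gt_eqF.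
rewrite -lee_fin fineK ?fin_num_measure //.
apply: (@le_trans _ _ (\int[lebesgue_measure]_(x in V) (c%:E * (normal_pdf m (2 * s) x)%:E))%E).
  apply: ge0_le_integral => //.
  - by move=> x _; rewrite lee_fin normal_pdf_ge0.
  - by apply/measurable_EFinP/measurable_funTS; exact: measurable_normal_pdf.
  - by apply: measurable_funeM; apply/measurable_EFinP/measurable_funTS; exact: measurable_normal_pdf.
  - move=> x Vx; rewrite -EFinM lee_fin normal_pdf_double // ler_wpM2r ?normal_pdf_ge0 //.
    rewrite ler_wpM2l // ler_expR lerN2 ler_wpM2l //.
    rewrite !expr_div_n ler_wpM2r ?invr_ge0 ?sqr_ge0 // -(real_normK (num_real (x - m))).
    by rewrite lerXn2r ?nnegrE // Ve.
rewrite ge0_integralZl_EFin //.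
- by rewrite -[leRHS]mule1 lee_wpmul2l ?lee_fin // -/(normal_prob m (2 * s) V) probability_le1.
- by move=> x _; rewrite lee_fin normal_pdf_ge0.
- by apply/measurable_EFinP/measurable_funTS; exact: measurable_normal_pdf.
Qed.

Section cosine_uniqueness.
Context d (T : measurableType d) (R : realType) (P : probability T R).
Variables (X f : T -> R) (C : R).
Hypotheses (mX : measurable_fun setT X) (mf : measurable_fun setT f).
Hypothesis fC : forall w, `|f w| <= C.
Hypothesis f0 : forall a c, \int[P]_w (f w * cos (a * X w + c)) = 0.

Let C0 : 0 <= C. Proof. exact: le_trans (fC point). Qed.

(** Fubini applies because the bounding density has mass 1 in [x] for every [w], and is at most its
    peak for every [x]. The centre [Y w] is the constant 0 in the Fourier step and the random
    variable itself in the convolution step. *)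
Lemma Rintegral_kernel0 (s : R) (Y : T -> R) (K : T * R -> R) : s != 0 ->
  measurable_fun setT K -> (forall w x, `|K (w, x)| <= C * normal_pdf (Y w) s x) ->
  (forall x, \int[P]_w K (w, x) = 0) ->
  \int[P]_w (\int[lebesgue_measure]_x K (w, x)) = 0.
Proof.
move=> s0 mK Kle K0.
have ipdf m := @integrable_normal_pdf R m s.
apply: Rintegral_Fubini0 => //.
- apply: (@le_lt_trans _ _ (\int[P]_w (C%:E))%E); last first.
    by rewrite integral_cst //= probability_setT mule1 ltry.
  apply: ge0_le_integral => //.
  + by move=> w _; apply: integral_ge0 => x _; rewrite lee_fin.
  + apply: (@measurable_fun_fubini_tonelli_F _ _ _ _ _ (@lebesgue_measure R) (fun z => `|K z|%:E)).
      by apply/measurable_EFinP; apply: measurableT_comp.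
    by move=> z; rewrite lee_fin.
  + move=> w _.
    have -> : (C%:E = \int[lebesgue_measure]_x (C%:E * (normal_pdf (Y w) s x)%:E))%E.
      by rewrite integralZl // integral_normal_pdf mule1.
    apply: ge0_le_integral => //.
    * by apply/measurable_EFinP; apply: measurableT_comp => //; exact: (measurable_fun_pair2 (f:=K)).
    * by apply: measurable_funeM; apply/measurable_EFinP; exact: measurable_normal_pdf.
    * by move=> x _; rewrite -EFinM lee_fin Kle.
- move=> w; apply: (@le_integrable _ _ _ lebesgue_measure _ measurableT _
    (fun x => C%:E * (normal_pdf (Y w) s x)%:E)%E).
  + by apply/measurable_EFinP; exact: (measurable_fun_pair2 (f:=K)).
  + by move=> x _; rewrite -EFinM !abse_EFin lee_fin (le_trans (Kle _ _)) // ler_norm.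
  + exact: integrableZl.
- move=> x; apply: (@integrable_bounded _ _ _ P _ (fun w => K (w, x)) (C * normal_peak s)) => //.
    exact: (measurable_fun_pair1 (f:=K)).
  by move=> w _; rewrite (le_trans (Kle _ _)) // ler_wpM2l // normal_pdf_ub.
Qed.

(** A Gaussian density is itself a superposition of cosines: up to the factor [normal_peak s], its
    value at y is the integral of cos(x (y - u)) against the normal law of deviation 1/s. The
    hypothesis [f0] kills each of these cosines. *)
Lemma Rintegral_normal_pdf0 (u s : R) : 0 < s ->
  \int[P]_w (f w * normal_pdf u s (X w)) = 0.
Proof.
move=> s0; have sn0 : s != 0 by rewrite gt_eqF.
pose K (z : T * R) := f z.1 * (cos (z.2 * X z.1 + (- u * z.2)) * normal_pdf 0 s^-1 z.2).
have mX1 : measurable_fun setT (fun z : T * R => X z.1) by exact: measurableT_comp.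
have mK : measurable_fun setT K.
  apply: measurable_funM; first exact: measurableT_comp.
  apply: measurable_funM; last first.
    by apply: measurableT_comp => //; exact: measurable_normal_pdf.
  apply: (measurableT_comp (@measurable_cos R)).
  by apply: measurable_funD; apply: measurable_funM => //; exact: measurable_cst.
have Kle w x : `|K (w, x)| <= C * normal_pdf 0 s^-1 x.
  rewrite /K /= !normrM (ger0_norm (normal_pdf_ge0 _ _ _)) ler_pM //.
    by rewrite mulr_ge0 // normal_pdf_ge0.
  by rewrite ler_piMl ?normal_pdf_ge0 // cos_abs_le1.
have Kint : \int[P]_w (\int[lebesgue_measure]_x K (w, x)) = 0.
  apply: (@Rintegral_kernel0 s^-1 (fun=> 0)); rewrite ?invr_eq0 //.
  move=> x; rewrite /K /=.
  under eq_Rintegral do rewrite mulrA.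
  rewrite RintegralZr ?f0 ?mul0r //.
  apply: (@integrable_bounded _ _ _ P _ _ C) => //.
    apply: measurable_funM => //; apply: (measurableT_comp (@measurable_cos R)).
    by apply: measurable_funD => //; apply: measurable_funM.
  by move=> w _; rewrite normrM -[leRHS]mulr1 ler_pM // cos_abs_le1.
have E w : f w * normal_pdf u s (X w) = normal_peak s * \int[lebesgue_measure]_x K (w, x).
  rewrite /K /= RintegralZl //; last first.
    apply: (@integrable_mul_normal_pdf _ _ _ 1); last by move=> x; exact: cos_abs_le1.
    apply: (measurableT_comp (@measurable_cos R)).
    by apply: measurable_funD => //; apply: measurable_funM.
  have -> : (fun x : R => cos (x * X w + - u * x) * normal_pdf 0 s^-1 x) =
      (fun x : R => cos ((X w - u) * (x - 0) + 0) * normal_pdf 0 s^-1 x).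
    by apply/funext => x; congr (cos _ * _); ring.
  rewrite integral_cos_normal_pdf ?invr_gt0 // cos0 mul1r mulrCA; congr (_ * _).
  rewrite normal_pdfE // /normal_fun; congr (_ * expR _); by field.
under eq_Rintegral do rewrite E.
rewrite RintegralZl ?Kint ?mulr0 //.
(* The identity [E], read backwards, makes the inner integral visibly measurable and bounded in
   [w]. *)
have -> : (EFin \o (fun w => \int[lebesgue_measure]_x K (w, x))) =
    EFin \o (fun w => (normal_peak s)^-1 * (f w * normal_pdf u s (X w))).
  by apply/funext => w /=; rewrite E mulKf // gt_eqF // normal_peak_gt0.
apply: (@integrable_bounded _ _ _ P _ _ ((normal_peak s)^-1 * (C * normal_peak s))) => //.
  apply: measurable_funM => //; apply: measurable_funM => //.
  by apply: measurableT_comp => //; exact: measurable_normal_pdf.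
move=> w _; rewrite !normrM (ger0_norm (normal_pdf_ge0 _ _ _)).
rewrite normfV (ger0_norm (normal_peak_ge0 _)) ler_wpM2l ?invr_ge0 ?normal_peak_ge0 //.
by rewrite ler_pM ?normal_pdf_ge0 // normal_pdf_ub.
Qed.

(** The densities of the previous lemma are integrated over their centres in [V]; by symmetry in
    centre and argument this gives the mass of [V] under the normal law centred at [X w]. *)
Lemma Rintegral_normal_prob0 (s : R) (V : set R) : 0 < s -> measurable V ->
  \int[P]_w (f w * fine (normal_prob (X w) s V)) = 0.
Proof.
move=> s0 mV; have sn0 : s != 0 by rewrite gt_eqF.
pose K (z : T * R) := f z.1 * (normal_pdf (X z.1) s z.2 * \1_V z.2).
have mK : measurable_fun setT K.
  apply: measurable_funM; first exact: measurableT_comp.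
  apply: measurable_funM; last by apply: measurableT_comp => //; exact: measurable_indic.
  by apply: measurable_normal_pdf2 => //; exact: measurableT_comp.
have ind (x : R) : 0 <= \1_V x :> R by [].
have ind1 (x : R) : \1_V x <= 1 :> R by rewrite indicE lern1 leq_b1.
have Kle w x : `|K (w, x)| <= C * normal_pdf (X w) s x.
  rewrite /K /= !normrM (ger0_norm (normal_pdf_ge0 _ _ _)) (ger0_norm (ind _)) ler_pM //.
    by rewrite mulr_ge0 // normal_pdf_ge0.
  by rewrite ler_piMr ?normal_pdf_ge0.
have ipdf m := @integrable_normal_pdf R m s.
have Kint : \int[P]_w (\int[lebesgue_measure]_x K (w, x)) = 0.
  apply: (@Rintegral_kernel0 s X) => //.
  move=> x; rewrite /K /=.
  under eq_Rintegral do rewrite mulrA normal_pdf_sym //.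
  rewrite RintegralZr ?Rintegral_normal_pdf0 ?mul0r //.
  apply: (@integrable_bounded _ _ _ P _ _ (C * normal_peak s)) => //.
    by apply: measurable_funM => //; apply: measurableT_comp => //; exact: measurable_normal_pdf.
  move=> w _; rewrite normrM (ger0_norm (normal_pdf_ge0 _ _ _)).
  by rewrite ler_pM ?normal_pdf_ge0 // normal_pdf_ub.
rewrite -[RHS]Kint; apply: eq_Rintegral => w _; rewrite /K /= RintegralZl //.
  by rewrite -Rintegral_indicM.
apply: (@le_integrable _ _ _ lebesgue_measure _ measurableT _
      (fun x => (normal_pdf (X w) s x)%:E)) => //.
  by apply/measurable_EFinP; apply: measurable_funM => //; exact: measurable_normal_pdf.
move=> x _ /=; rewrite lee_fin normrM ler_piMr // ger0_norm //.
Qed.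

Lemma Rintegral_Iio0 (a : R) : \int[P]_w (f w * \1_`]-oo, a[ (X w)) = 0.
Proof.
(* The boundary is moved left by 1/(n+1) while the deviation is only 1/(n+1)^2. The shift is thus
   n+1 deviations long, so [phi n] tends to the indicator of ]-oo, a[ at every point, including 0 at
   the end point [a] itself. *)
pose s (n : nat) : R := (n.+1%:R ^+ 2)^-1.
pose V (n : nat) : set R := `]-oo, a - n.+1%:R^-1[%classic.
pose phi n y : R := fine (normal_prob y (s n) (V n)).
have s0 n : 0 < s n by rewrite invr_gt0 exprn_gt0.
have mV n : measurable (V n) by exact: measurable_itv.
have phi0 n y : 0 <= phi n y by exact: fine_ge0.
have phi1 n y : phi n y <= 1.
  have H := @probability_le1 _ _ _ (normal_prob y (s n)) (V n) (mV n).
  by rewrite -lee_fin /phi fineK; [exact: H|exact: normal_prob_fin_num].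
(* At distance 1/(n+1), that is n+1 deviations, the tail is at most 2 exp(-3/8 (n+1)^2). The
   inequality exp u >= 1 + u turns this into O(1/(n+1)), and 6 is a comfortable constant. *)
have tail n y (B : set R) : measurable B -> (forall u, B u -> n.+1%:R^-1 <= `|u - y|) ->
    fine (normal_prob y (s n) B) <= 6 * harmonic n.
  move=> mB By; apply: le_trans (normal_prob_tail (s0 n) _ mB By) _; first by rewrite invr_ge0.
  have -> : n.+1%:R^-1 / s n = n.+1%:R by rewrite /s invrK expr2 mulKf // pnatr_eq0.
  rewrite /harmonic.
  have N1 : 1 <= n.+1%:R :> R by rewrite ler1n.
  have e1 := expR_ge1Dx (3 / 8 * n.+1%:R ^+ 2 : R).
  rewrite expRN ler_pdivrMr ?expR_gt0 //.
  rewrite mulrAC ler_pdivlMr //; nra.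
have near_h (e : R) : 0 < e -> \forall n \near \oo, n.+1%:R^-1 <= e.
  move=> e0; have /cvgrPdist_le /(_ _ e0) := @cvg_harmonic R.
  by apply: filterS => n; rewrite /harmonic sub0r normrN ger0_norm ?invr_ge0.
have cvg6 : (fun n => 6 * harmonic n : R) n @[n --> \oo] --> 0.
  by rewrite -[X in _ --> X](mulr0 (6 : R)); apply: cvgM; [exact: cvg_cst|exact: cvg_harmonic].
have cphi y : phi n y @[n --> \oo] --> (\1_`]-oo, a[ y : R).
  rewrite indicE; have [ya|ay] := ltP y a.
    rewrite mem_set /= ?in_itv //=.
    have -> : (1%:R : R) = 1 - 0 by rewrite subr0.
    have -> : (fun n => phi n y) = (fun n => 1 - fine (normal_prob y (s n) (~` V n))).
      by apply/funext => n; exact: normal_prob_fineC.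
    apply: cvgB; first exact: cvg_cst.
    apply: (@squeeze_cvgr _ _ _ _ (fun=> 0) (fun n => 6 * harmonic n)) => //; last exact: cvg_cst.
    (* Once 1/(n+1) <= (a - y)/2, the shifted boundary is still at distance at least 1/(n+1) to the
       right of [y]. *)
    have /near_h : 0 < (a - y) / 2 by rewrite divr_gt0 // subr_gt0.
    apply: filterS => n nay; rewrite fine_ge0 //=; apply: tail; first exact: measurableC.
    move=> u; rewrite /V /= in_itv /= => /negP; rewrite -leNgt => au.
    apply: le_trans (ler_norm _); move: (n.+1%:R^-1) nay au => h nay au; lra.
  rewrite memNset /= ?in_itv /= ?ltNge ?ay //.
  apply: (@squeeze_cvgr _ _ _ _ (fun=> 0) (fun n => 6 * harmonic n)) => //; last exact: cvg_cst.
  apply: nearW => n; rewrite phi0 /=; apply: tail => // u.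
  rewrite /V /= in_itv /= => au; rewrite distrC; apply: le_trans (ler_norm _).
  by move: (n.+1%:R^-1) au => h au; lra.
have mphi n : measurable_fun setT (fun w => f w * phi n (X w)).
  apply: measurable_funM => //; apply: measurableT_comp => //.
  by apply: measurable_normal_prob_mean => //; rewrite gt_eqF.
have := @dominated_cvg _ _ _ P setT measurableT (fun n w => (f w * phi n (X w))%:E)
  (fun w => (f w * \1_`]-oo, a[ (X w))%:E) (cst C%:E).
have -> : (fun n => \int[P]_w (f w * phi n (X w))%:E)%E = cst 0%E.
  apply/funext => n /=; have := Rintegral_normal_prob0 (s0 n) (mV n); rewrite /Rintegral => E.
  rewrite -[LHS]fineK ?E //; apply: integrable_fin_num => //.
  apply: (@integrable_bounded _ _ _ P _ _ C) => // w _.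
  by rewrite normrM -[leRHS]mulr1 ler_pM // ger0_norm.
move=> H.
have : (cst 0%E : nat -> \bar R) n @[n --> \oo] --> (\int[P]_w (f w * \1_`]-oo, a[ (X w))%:E)%E.
  apply: H => //.
  - by move=> n; apply/measurable_EFinP.
  - move=> w _; apply: cvg_EFin; first exact: nearW.
    by apply: cvgM; [exact: cvg_cst|exact: cphi].
  - exact: finite_measure_integrable_cst.
  - by move=> n w _; rewrite lee_fin normrM -[leRHS]mulr1 ler_pM // ger0_norm.
move=> /(cvg_lim (@ereal_hausdorff R)); rewrite lim_cst // /Rintegral => <-.
by [].
Qed.

(** This is injectivity of the Fourier transform for the image under [X] of the signed measure of
    density [f]: half-lines form a pi-system generating the Borel sets, and their preimages carry no
    mass. *)
Theorem Rintegral_preimage0 (B : set R) : measurable B -> \int[P]_(w in X @^-1` B) f w = 0.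
Proof.
move=> mB.
have ff : \int[P]_w f w = 0.
  rewrite -(f0 0 0); apply: eq_Rintegral => w _.
  by rewrite mul0r addr0 cos0 mulr1.
have if_ : P.-integrable setT (EFin \o f) by exact: (@integrable_bounded _ _ _ P _ _ C).
pose G := preimage_set_system setT X (@RGenInftyO.G R).
apply: (Rintegral_dynkin (G := G) if_ _ _ ff).
- move=> A A' [_ [a ->] <-] [_ [a' ->] <-].
  exists `]-oo, (Num.min a a')[%classic; first by exists (Num.min a a').
  rewrite !setTI -preimage_setI; congr (_ @^-1` _).
  by apply/seteqP; split => x /=; rewrite !in_itv /= lt_min => /andP.
- move=> A [_ [a ->] <-]; apply: mX => //; exact: measurable_itv.
- move=> A [_ [a ->] <-]; rewrite setTI Rintegral_indicM.
  exact: Rintegral_Iio0.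
- rewrite /G g_sigma_preimageE; exists B; last by rewrite setTI.
  by rewrite -RGenInftyO.measurableE.
Qed.

End cosine_uniqueness.

(** * Gaussian random variables *)

(** The Radon-Nikodym derivative of the normal law agrees almost everywhere with the explicit
    density, both having the same integral over each measurable set. *)
Lemma integral_normal_prob (R : realType) (m s : R) (g : R -> \bar R) :
  (normal_prob m s).-integrable setT g ->
  (\int[normal_prob m s]_x g x = \int[lebesgue_measure]_x (g x * (normal_pdf m s x)%:E))%E.
Proof.
move=> ig; have dom := @normal_prob_dominates R m s.
have mg := measurable_int _ ig.
rewrite -(Radon_Nikodym_change_of_variables dom) //=.
apply: ae_eq_integral => //.
- by apply: emeasurable_funM => //; apply: (measurable_int lebesgue_measure).
- by apply: emeasurable_funM => //=; apply/measurable_EFinP; exact: measurable_normal_pdf.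
- apply: ae_eqe_mul2l => /=.
  rewrite Radon_NikodymE //=.
  case: cid => /= h [h1 h2 h3].
  apply: integral_ae_eq => //=.
  + by apply/measurable_EFinP; exact: measurable_normal_pdf.
  + by move=> E _ mE; rewrite -h3.
Qed.

Section gaussian_variable.
Context d (T : measurableType d) (R : realType) (P : probability T R).

Lemma integral_law d' (U : measurableType d') (X : T -> U) (nu : probability U R) (g : U -> R) (C : R) :
  measurable_fun setT X -> (forall A, measurable A -> P (X @^-1` A) = nu A) ->
  measurable_fun setT g -> (forall x, `|g x| <= C) ->
  \int[P]_w g (X w) = \int[nu]_x g x.
Proof.
move=> mX law mg gC; congr fine.
transitivity (\int[pushforward P X]_x (g x)%:E)%E.
  rewrite integral_pushforward //; first exact/measurable_EFinP.
  rewrite preimage_setT; apply: (@integrable_bounded _ _ _ P _ (g \o X) C) => //.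
    exact: measurableT_comp.
  by move=> w _; exact: gC.
by apply: eq_measure_integral => A mA _; exact: law.
Qed.

Lemma gaussian_law_cos (X : T -> R) (mu v c : R) : measurable_fun setT X -> 0 <= v ->
  has_gaussian_law P X mu v ->
  \int[P]_w cos (X w - mu + c) = cos c * expR (- (v / 2)).
Proof.
move=> mX v0 law; pose g x := cos (x - mu + c).
have mg : measurable_fun setT g.
  apply: (measurableT_comp (@measurable_cos R)).
  by apply: measurable_funD => //; exact: measurable_funB.
have g1 x : `|g x| <= 1 by exact: cos_abs_le1.
have [ve|vn] := eqVneq v 0.
  rewrite (integral_law (nu := dirac mu) mX _ mg g1).
    rewrite /Rintegral integral_dirac ?diracT ?mul1e //=; last exact/measurable_EFinP.
    by rewrite /g subrr add0r ve mul0r oppr0 expR0 mulr1.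
  by move=> A mA; rewrite law // /gaussian_law ve eqxx.
have s0 : 0 < Num.sqrt v by rewrite sqrtr_gt0 lt_neqAle eq_sym vn.
rewrite (integral_law (nu := normal_prob mu (Num.sqrt v)) mX _ mg g1); last first.
  by move=> A mA; rewrite law // /gaussian_law (negbTE vn).
have := @integral_cos_normal_pdf R mu (Num.sqrt v) c 1 s0.
rewrite sqr_sqrtr // expr1n mulr1 => <-.
rewrite /Rintegral integral_normal_prob; last first.
  exact: (@integrable_bounded _ _ _ (normal_prob mu (Num.sqrt v)) _ g 1).
by congr fine; apply: eq_integral => x _; rewrite /g mul1r EFinM.
Qed.

Lemma normal_prob_sd0 (m a : R) : 0 <= a <= 1 -> normal_prob m 0 `]-oo, a] = a%:E.
Proof.
move=> /andP[a0 a1]; rewrite /normal_prob /normal_pdf eqxx.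
rewrite integral_indic // (_ : _ `&` _ = `[0, a]%classic); last first.
  apply/seteqP; split => x /=; rewrite !in_itv /=.
    by move=> [/andP[-> _] ->].
  by move=> /andP[-> xa]; rewrite xa (le_trans xa).
apply: (etrans (lebesgue_measure_itv _)); rewrite /= lte_fin.
by case: ltgtP a0 => // [_|<-] _; rewrite ?oppr0 ?adde0.
Qed.

(* A negative formal variance would be read by [normal_prob] as standard deviation 0, that is
   as the uniform law on [0, 1], which is incompatible with scaling by 2. *)
Lemma gaussian_process_variance_ge0 (W : R -> T -> R) (m : R -> R) (Sig : R -> R -> R)
    n (ts : 'I_n -> R) (a : 'I_n -> R) : gaussian_process P W m Sig ->
  0 <= \sum_(i < n) \sum_(j < n) a i * a j * Sig (ts i) (ts j).
Proof.
move=> [_ law]; rewrite leNgt; apply/negP => v0.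
have law0 (k : R) (A : set R) : 0 < k -> measurable A ->
    P ((fun w => \sum_(i < n) (k * a i) * W (ts i) w) @^-1` A) =
    normal_prob (\sum_(i < n) (k * a i) * m (ts i)) 0 A.
  move=> k0 mA; rewrite law //.
  have -> : \sum_(i < n) \sum_(j < n) k * a i * (k * a j) * Sig (ts i) (ts j) =
      k ^+ 2 * \sum_(i < n) \sum_(j < n) a i * a j * Sig (ts i) (ts j).
    rewrite mulr_sumr; apply: eq_bigr => i _; rewrite mulr_sumr; apply: eq_bigr => j _.
    by rewrite expr2; ring.
  have neg : k ^+ 2 * \sum_(i < n) \sum_(j < n) a i * a j * Sig (ts i) (ts j) < 0.
    by rewrite pmulr_rlt0 // exprn_gt0.
  by rewrite /gaussian_law (lt_eqF neg) (ltr0_sqrtr neg).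
(* The events X <= 1/2 and 2X <= 1 coincide, but would have probabilities 1/2 and 1. *)
have := law0 1 `]-oo, 2^-1]%classic ltr01 (measurable_itv _).
rewrite normal_prob_sd0; last lra.
have := law0 2 `]-oo, 1]%classic (ltr0n _ 2) (measurable_itv _).
rewrite normal_prob_sd0; last lra.
rewrite (_ : _ @^-1` `]-oo, 1] =
  (fun w => \sum_(i < n) 1 * a i * W (ts i) w) @^-1` `]-oo, 2^-1]) => [-> [H]|].
  by move: H; lra.
apply/seteqP; split => w /=; rewrite !in_itv /=.
  under eq_bigr do rewrite -mulrA.
  rewrite -mulr_sumr.
  under [X in _ -> X <= _]eq_bigr do rewrite mul1r. lra.
under eq_bigr do rewrite mul1r.
under [X in _ -> X <= _]eq_bigr do rewrite -mulrA.
rewrite -mulr_sumr; lra.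
Qed.
End gaussian_variable.

(** * Independence from joint cosine integrals *)

Lemma cosMcos (R : realType) (x y : R) : cos x * cos y = 2^-1 * (cos (x + y) + cos (x - y)).
Proof. by rewrite cosD cosB; field. Qed.

Section independence.
Context d (T : measurableType d) (R : realType) (P : probability T R) (I : Type).
Variables (Z : T -> R) (Y : I -> T -> R).
Hypotheses (mZ : measurable_fun setT Z) (mY : forall i, measurable_fun setT (Y i)).

Definition lincomb (l : seq (R * I)) (w : T) : R := \sum_(p <- l) p.1 * Y p.2 w.

(** A pi-system generating the sigma-algebra of the family [Y]. The inductive form, with the whole
    space as base case, supports an induction that adds one coordinate event at a time. *)
Inductive cylinder : set T -> Prop :=
  | cylinderT : cylinder setT
  | cylinderI i B K : measurable B -> cylinder K -> cylinder (Y i @^-1` B `&` K).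

(** These stand for the characteristic functions of [Z] and of the linear combinations of the [Y i],
    real-valued as for centred Gaussian laws. In these terms [joint_cos] says that the joint
    characteristic function factorizes. *)
Variables (kappa : R -> R) (psi : seq (R * I) -> R).
Hypotheses (kappa0 : kappa 0 = 1) (kappaN : forall a, kappa (- a) = kappa a).
Hypothesis psi0 : psi [::] = 1.
Hypothesis joint_cos : forall a l c,
  \int[P]_w cos (a * Z w + lincomb l w + c) = cos c * kappa a * psi l.

Lemma measurable_lincomb l : measurable_fun setT (lincomb l).
Proof.
rewrite /lincomb; elim: l => [|p l IH].
  by under eq_fun do rewrite big_nil; exact: measurable_cst.
under eq_fun do rewrite big_cons.
by apply: measurable_funD => //; apply: measurable_funM.
Qed.

Lemma measurable_cos_comp (X : T -> R) c :
  measurable_fun setT X -> measurable_fun setT (fun w => cos (X w + c)).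
Proof. by move=> mX; apply: (measurableT_comp (@measurable_cos R)); exact: measurable_funD. Qed.

Lemma cylinder_measurable K : cylinder K -> measurable K.
Proof.
by elim=> // i B K' mB _ mK'; apply: measurableI => //; rewrite -[X in measurable X]setTI; exact: mY.
Qed.

Lemma cylinder_setI : setI_closed cylinder.
Proof.
move=> K K' cK cK'; elim: cK => [|i B L mB _ IH]; first by rewrite setTI.
by rewrite -setIA; exact: cylinderI.
Qed.

Let ib (f : T -> R) : measurable_fun setT f -> (exists C, forall w, `|f w| <= C) ->
  P.-integrable setT (EFin \o f).
Proof. by move=> mf [C fC]; exact: (@integrable_bounded _ _ _ P _ _ C). Qed.

Let intE (f g : T -> R) (k : R) : measurable_fun setT f -> (exists C, forall w, `|f w| <= C) ->
  measurable_fun setT g -> (exists C, forall w, `|g w| <= C) ->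
  \int[P]_w (k * (f w + g w)) = k * (\int[P]_w f w + \int[P]_w g w).
Proof.
move=> mf [C fC] mg [D gD]; rewrite RintegralZl ?RintegralD //; try exact: ib.
- by apply: ib; [exact|exists C].
- by apply: ib; [exact|exists D].
apply: ib; first exact: measurable_funD.
by exists (C + D) => w; apply: le_trans (ler_normD _ _) _; exact: lerD.
Qed.

Let bcos (h : T -> R) : exists C, forall w, `|cos (h w)| <= C.
Proof. by exists 1 => w; exact: cos_abs_le1. Qed.

(** In other words, the conditional expectation of the cosine given [Z] is constant. By
    [Rintegral_preimage0] it is enough to test against cos(aZ + b), and the product-to-sum formula
    brings this back to [joint_cos]. *)
Lemma Rintegral_cos_cond A l c : measurable A ->
  \int[P]_(w in Z @^-1` A) (cos (lincomb l w + c) - cos c * psi l) = 0.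
Proof.
move=> mA; set e := cos c * _.
have mL b : measurable_fun setT (fun w => cos (lincomb l w + b)).
  by apply: measurable_cos_comp; exact: measurable_lincomb.
have mZL a k b : measurable_fun setT (fun w => cos (a * Z w + lincomb k w + b)).
  apply: measurable_cos_comp; apply: measurable_funD; last exact: measurable_lincomb.
  exact: measurable_funM.
apply: (@Rintegral_preimage0 _ _ _ P Z _ (1 + `|e|)) => //.
- exact: measurable_funB.
- by move=> w; apply: le_trans (ler_normB _ _) _; rewrite lerD2r cos_abs_le1.
- move=> a b.
  have Ew w : (cos (lincomb l w + c) - e) * cos (a * Z w + b) =
      2^-1 * (cos (a * Z w + lincomb l w + (c + b)) + cos (- a * Z w + lincomb l w + (c - b))) +
      (- e) * cos (a * Z w + lincomb [::] w + b).
    have -> : a * Z w + lincomb l w + (c + b) = (lincomb l w + c) + (a * Z w + b) by ring.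
    have -> : - a * Z w + lincomb l w + (c - b) = (lincomb l w + c) - (a * Z w + b) by ring.
    have -> : lincomb [::] w = 0 by rewrite /lincomb big_nil.
    by rewrite -cosMcos addr0; ring.
  under eq_Rintegral do rewrite Ew.
  rewrite RintegralD //; first last.
  + apply: ib; first by apply: measurable_funM.
    by exists `|e| => w; rewrite normrM normrN ler_piMr // cos_abs_le1.
  + apply: ib; first by apply: measurable_funM => //; apply: measurable_funD.
    exists (2^-1 * (1 + 1)) => w; rewrite normrM ger0_norm // ler_wpM2l //.
    by apply: le_trans (ler_normD _ _) _; rewrite lerD // cos_abs_le1.
  rewrite intE // RintegralZl //; last exact: ib.
  rewrite !joint_cos kappaN psi0 /e.
  have := cosMcos c b; rewrite mulrDr => E.
  (* Evenness of [kappa] lets kappa(a) psi(l) be factored out of all three terms; the bracket is the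
     product formula for cos c cos b. *)
  transitivity (kappa a * psi l * (2^-1 * cos (c + b) + 2^-1 * cos (c - b) - cos c * cos b)); first ring.
  by rewrite E subrr mulr0.
Qed.

Section conditioning_event.
Variables (A : set R).
Hypothesis mA : measurable A.

(** Centred indicator: its integral over [H] is P(Z in A, H) - P(Z in A) P(H), so independence
    amounts to these integrals being zero. *)
Let g (w : T) : R := \1_A (Z w) - fine (P (Z @^-1` A)).

Let mZA : measurable (Z @^-1` A).
Proof. by rewrite -[X in measurable X]setTI; exact: mZ. Qed.

Let mg : measurable_fun setT g.
Proof.
apply: measurable_funB => //; apply: measurableT_comp => //; exact: measurable_indic.
Qed.

Let bg w : `|g w| <= 2.
Proof.
apply: le_trans (ler_normB _ _) _.
have p0 : 0 <= fine (P (Z @^-1` A)) by exact: fine_ge0.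
have p1 : fine (P (Z @^-1` A)) <= 1.
  by rewrite -lee_fin fineK ?fin_num_measure // probability_le1.
have i1 : `|\1_A (Z w) : R| <= 1.
  by rewrite indicE; case: (_ \in _); rewrite ?normr1 ?normr0.
by rewrite (ger0_norm p0) -[2]/(1 + 1) lerD.
Qed.

(* The sets [Y i @^-1` B] are brought in one at a time, each one trading a cosine of [Y i]. *)
Lemma Rintegral_cylinder_cos K : cylinder K -> forall l c,
  \int[P]_w (g w * \1_K w * cos (lincomb l w + c)) = 0.
Proof.
have mL l b : measurable_fun setT (fun w => cos (lincomb l w + b)).
  by apply: measurable_cos_comp; exact: measurable_lincomb.
elim=> [|i B K' mB cK IH] l c.
  have iL : P.-integrable setT (EFin \o (fun w => cos (lincomb l w + c))) by exact: ib.
  have := @Rintegral_cos_cond A l c mA.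
  have -> : cos c * psi l = \int[P]_w cos (lincomb l w + c).
    rewrite -[psi l]mul1r -kappa0 mulrA -joint_cos.
    by apply: eq_Rintegral => w _; rewrite mul0r add0r.
  rewrite RintegralB //; first last.
  - exact: finite_measure_integrable_cst.
  - by apply: (integrableS measurableT).
  rewrite Rintegral_cst // Rintegral_indicM => H.
  transitivity (\int[P]_w (cos (lincomb l w + c) * \1_(Z @^-1` A) w
      - fine (P (Z @^-1` A)) * cos (lincomb l w + c))).
    by apply: eq_Rintegral => w _; rewrite indicT mulr1 mulrBl mulrC.
  rewrite RintegralB //; first last.
  - apply: ib; first exact: measurable_funM.
    exists (`|fine (P (Z @^-1` A))| * 1) => w.
    by rewrite normrM ler_wpM2l // cos_abs_le1.
  - apply: ib; first by apply: measurable_funM => //; exact: measurable_indic.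
    exists 1 => w; rewrite normrM -[leRHS]mulr1 ler_pM // ?cos_abs_le1 //.
    by rewrite indicE; case: (_ \in _); rewrite ?normr1 ?normr0.
  by rewrite RintegralZl // mulrC.
have mK' := cylinder_measurable cK.
pose f w := g w * \1_K' w * cos (lincomb l w + c).
have b1 (w : T) : `|\1_K' w : R| <= 1.
  by rewrite indicE; case: (_ \in _); rewrite ?normr1 ?normr0.
have mgK : measurable_fun setT (fun w => g w * \1_K' w).
  by apply: measurable_funM => //; exact: measurable_indic.
have bgK h : exists C, forall w, `|g w * \1_K' w * cos (h w)| <= C.
  exists 2 => w; rewrite normrM -[leRHS]mulr1 ler_pM // ?cos_abs_le1 //.
  by rewrite normrM -[leRHS]mulr1 ler_pM.
have mgKL k b : measurable_fun setT (fun w => g w * \1_K' w * cos (lincomb k w + b)).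
  exact: measurable_funM.
rewrite -[RHS](@Rintegral_preimage0 _ _ _ P (Y i) f 2 (mY i) _ _ _ B mB).
- rewrite [RHS]Rintegral_indicM; apply: eq_Rintegral => w _.
  rewrite /f indicI /=; have -> : \1_(Y i @^-1` B) w = \1_B (Y i w) :> R by [].
  ring.
- exact: mgKL.
- by move=> w; rewrite /f !normrM -[leRHS]mulr1 -(mulr1 (2 * 1)) !ler_pM // cos_abs_le1.
- move=> a b.
  (* The cosine of [Y i] is absorbed into the linear combination, which gains the entry (a, i) or
     (-a, i). The induction hypothesis must therefore hold for all [l] and [c]. *)
  have Ew w : f w * cos (a * Y i w + b) =
      2^-1 * (g w * \1_K' w * cos (lincomb ((a, i) :: l) w + (c + b)) +
              g w * \1_K' w * cos (lincomb ((- a, i) :: l) w + (c - b))).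
    rewrite /f /lincomb !big_cons /= -!/(lincomb l w).
    have -> : a * Y i w + lincomb l w + (c + b) = (lincomb l w + c) + (a * Y i w + b) by ring.
    have -> : - a * Y i w + lincomb l w + (c - b) = (lincomb l w + c) - (a * Y i w + b) by ring.
    by rewrite -mulrA cosMcos; ring.
  under eq_Rintegral do rewrite Ew.
  by rewrite intE // !IH addr0 mulr0.
Qed.

(** With the empty combination and zero phase the cosine is 1, so [g] integrates to 0 over each
    cylinder; the pi-lambda argument does the rest. *)
Theorem independent_sigma_cylinder H : <<s cylinder >> H ->
  P (Z @^-1` A `&` H) = (P (Z @^-1` A) * P H)%E.
Proof.
move=> sH.
have ig : P.-integrable setT (EFin \o g) by apply: ib => //; exists 2.
have cyl0 K : cylinder K -> \int[P]_(w in K) g w = 0.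
  move=> cK; rewrite [LHS]Rintegral_indicM -[RHS](Rintegral_cylinder_cos cK [::] 0).
  by apply: eq_Rintegral => w _; rewrite /lincomb big_nil addr0 cos0 mulr1.
have g0 : \int[P]_w g w = 0 by apply: cyl0; exact: cylinderT.
have mH : measurable H.
  move: sH; apply: smallest_sub; first exact: sigma_algebra_measurable.
  exact: cylinder_measurable.
have := Rintegral_dynkin ig cylinder_setI cylinder_measurable g0 cyl0 sH.
rewrite RintegralB //; first last.
- exact: finite_measure_integrable_cst.
- apply: (integrableS measurableT) => //; apply: ib.
    by apply: measurableT_comp => //; exact: measurable_indic.
  by exists 1 => w; rewrite indicE; case: (_ \in _); rewrite ?normr1 ?normr0.
rewrite Rintegral_cst // {1}/Rintegral.
have -> : (fun w => (\1_A (Z w))%:E : \bar R) = (fun w => (\1_(Z @^-1` A) w)%:E) by [].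
rewrite integral_indic // => /eqP; rewrite subr_eq0 => /eqP E.
rewrite -[LHS]fineK ?fin_num_measure //; last exact: measurableI.
by rewrite E EFinM !fineK ?fin_num_measure.
Qed.

End conditioning_event.
End independence.

(** * Paths of Q *)

Section Phi_facts.
Context {R : realType}.
Implicit Types (m s a b x y : R).

Lemma integral_cst_oc a b c : a <= b ->
  (\int[lebesgue_measure]_(x in `]a, b]) c%:E = (c * (b - a))%:E)%E.
Proof.
move=> ab; rewrite integral_cst // EFinM; congr (_ * _)%E.
apply: (etrans (lebesgue_measure_itv _)); rewrite /= lte_fin.
by move: ab; rewrite le_eqVlt => /predU1P[->|->]; rewrite ?ltxx ?subrr // EFinB.
Qed.

Lemma normal_prob_itv_le m s a b : s != 0 -> a <= b ->
  fine (normal_prob m s `]a, b]) <= normal_peak s * (b - a).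
Proof.
move=> s0 ab; rewrite -lee_fin fineK ?normal_prob_fin_num //.
apply: (@le_trans _ _ (\int[lebesgue_measure]_(x in `]a, b]) (normal_peak s)%:E)%E).
  apply: ge0_le_integral => //.
  - by move=> x _; rewrite lee_fin normal_pdf_ge0.
  - by apply/measurable_EFinP/measurable_funTS; exact: measurable_normal_pdf.
  - by move=> x _; rewrite lee_fin normal_pdf_ub.
by rewrite integral_cst_oc.
Qed.

Lemma normal_prob_itv_gt0 m s a b : s != 0 -> a < b -> 0 < fine (normal_prob m s `]a, b]).
Proof.
move=> s0 ab.
(* [M] bounds |x - m| on the interval, hence [c] bounds the density there from below. *)
pose M := `|a - m| + `|b - m|.
pose c := normal_peak s * expR (- M ^+ 2 / (s ^+ 2 *+ 2)).
have c0 : 0 < c by rewrite mulr_gt0 ?expR_gt0 ?normal_peak_gt0.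
apply: (@lt_le_trans _ _ (c * (b - a))); first by rewrite mulr_gt0 // subr_gt0.
rewrite -lee_fin fineK ?normal_prob_fin_num //.
apply: (@le_trans _ _ (\int[lebesgue_measure]_(x in `]a, b]) c%:E)%E).
  by rewrite integral_cst_oc // ltW.
apply: ge0_le_integral => //.
- by move=> x _; rewrite lee_fin ltW.
- by apply/measurable_EFinP/measurable_funTS; exact: measurable_normal_pdf.
- move=> x /=; rewrite in_itv /= => /andP[ax xb]; rewrite lee_fin normal_pdfE // /normal_fun.
  rewrite ler_wpM2l ?normal_peak_ge0 // ler_expR ler_wpM2r ?invr_ge0 ?mulrn_wge0 ?sqr_ge0 //.
  rewrite lerN2 -(real_normK (num_real (x - m))) lerXn2r ?nnegrE ?addr_ge0 //.
  have := ler_norm (b - m); have := ler_norm (- (a - m)); rewrite normrN.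
  have := normr_ge0 (b - m); have := normr_ge0 (a - m); rewrite /M => *.
  by rewrite ler_norml; apply/andP; split; lra.
Qed.

Lemma PhiB x y : x <= y -> Phi y - Phi x = fine (normal_prob 0 1 `]x, y]).
Proof.
move=> xy; rewrite /Phi.
have -> : `]-oo, y]%classic = `]-oo, x] `|` `]x, y].
  by rewrite -itv_bndbnd_setU // bnd_simp.
rewrite measureU //; last first.
  by apply/seteqP; split => // z [] /=; rewrite !in_itv /= => zx /andP[]; rewrite ltNge zx.
by rewrite fineD ?normal_prob_fin_num // addrC addKr.
Qed.

Lemma Phi_ge0 x : 0 <= Phi x.
Proof. exact: fine_ge0. Qed.

Lemma Phi_le1 x : Phi x <= 1.
Proof.
rewrite -lee_fin fineK ?normal_prob_fin_num //.
exact: (probability_le1 (normal_prob 0 1)).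
Qed.

Lemma Phi_lt x y : x < y -> Phi x < Phi y.
Proof.
by move=> xy; rewrite -subr_gt0 PhiB ?ltW // normal_prob_itv_gt0 ?oner_neq0.
Qed.

(** [Phi] is Lipschitz, with the peak of the standard normal density as constant. *)
Lemma Phi_continuous : continuous (@Phi R).
Proof.
pose k : R := normal_peak 1.
have k0 : 0 < k by exact: normal_peak_gt0 (oner_neq0 _).
have lip x y : x <= y -> `|Phi y - Phi x| <= k * (y - x).
  move=> xy; rewrite PhiB // ger0_norm ?fine_ge0 //.
  by rewrite normal_prob_itv_le // oner_neq0.
have lip' x y : `|Phi y - Phi x| <= k * `|y - x|.
  have [xy|/ltW yx] := leP x y; first by rewrite (ger0_norm (_ : 0 <= y - x)) ?subr_ge0 // lip.
  by rewrite distrC (distrC y) (ger0_norm (_ : 0 <= x - y)) ?subr_ge0 // lip.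
move=> x; apply/cvgrPdist_le => e e0; near=> y.
apply: le_trans (lip' _ _) _; rewrite mulrC -ler_pdivlMr //.
near: y; apply: cvgr_dist_le => //; exact: divr_gt0.
Unshelve. all: by end_near. Qed.

End Phi_facts.

Section Qfun_facts.
Context {R : realType}.
Implicit Types (f g : R -> R) (a b t : R).
Notation mu := (@lebesgue_measure R).

Lemma continuous_integrable_itv f a b : continuous f -> mu.-integrable `[a, b] (EFin \o f).
Proof.
move=> cf; apply: continuous_compact_integrable; first exact: segment_compact.
exact: continuous_subspaceT.
Qed.

(** The sign convention of [oint0] for negative bounds makes Chasles' relation hold wherever 0 lies
    relative to [a] and [b], whence the three cases. *)
Lemma oint0B f a b : continuous f -> a <= b -> oint0 f b - oint0 f a = \int[mu]_(x in `[a, b]) f x.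
Proof.
move=> cf ab; have ci u v := continuous_integrable_itv u v cf.
have E u v w : u <= v -> v <= w ->
    \int[mu]_(x in `[u, w]) f x = \int[mu]_(x in `[u, v]) f x + \int[mu]_(x in `[v, w]) f x.
  move=> uv vw; have := @Rintegral_itvB R f (BLeft u) (BRight w) v (ci u w).
  rewrite !bnd_simp => /(_ uv vw); rewrite (Rintegral_itv_obnd_cbnd (r := v)).
    by move=> /eqP; rewrite subr_eq addrC => /eqP.
  apply: (@integrableS _ _ _ mu `[v, w]%classic) => //.
    exact: subset_itv_oc_cc.
rewrite /oint0; have [a0|a0] := leP 0 a.
  by rewrite (le_trans a0 ab) (E 0 a b) // addrC addKr.
have [b0|b0] := leP 0 b; first by rewrite opprK (E a 0 b) ?(ltW a0) // addrC.
by rewrite opprK (E a b 0) ?(ltW b0) // addrC addrK.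
Qed.

Lemma Rintegral_itv_ge f a b c : continuous f -> a <= b ->
  (forall x, x \in `[a, b] -> c <= f x) -> c * (b - a) <= \int[mu]_(x in `[a, b]) f x.
Proof.
move=> cf ab cf'.
have -> : c * (b - a) = \int[mu]_(x in `[a, b]) c.
  rewrite Rintegral_cst //; congr (_ * _); apply/esym/(congr1 fine (y := (b - a)%:E)).
  apply: (etrans (lebesgue_measure_itv _)); rewrite /= lte_fin.
  by move: ab; rewrite le_eqVlt => /predU1P[->|->]; rewrite ?ltxx ?subrr // EFinB.
apply: le_Rintegral => //; apply: continuous_integrable_itv => //.
by move=> x; exact: cvg_cst.
Qed.

(** Strictness survives integration because the continuous function g - f attains a positive minimum
    on the compact interval. *)
Lemma Rintegral_itv_lt f g a b : continuous f -> continuous g -> a < b ->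
  (forall x, f x < g x) -> \int[mu]_(x in `[a, b]) f x < \int[mu]_(x in `[a, b]) g x.
Proof.
move=> cf cg ab fg.
have ch : continuous (fun x => g x - f x) by move=> x; apply: cvgB; [exact: cg|exact: cf].
rewrite -subr_gt0 -RintegralB //; [|exact: continuous_integrable_itv..].
have [c _ cmin] := EVT_min (ltW ab) (continuous_subspaceT ch : {within `[a, b], continuous _}).
apply: lt_le_trans (Rintegral_itv_ge ch (ltW ab) cmin).
by rewrite mulr_gt0 // subr_gt0.
Qed.

Lemma continuous_Phi_comp f : continuous f -> continuous (fun y => Phi (f y)).
Proof. by move=> cf x; apply: continuous_comp; [exact: cf|exact: Phi_continuous]. Qed.

Lemma QfunB (gamma : R) f a b : continuous f -> a <= b ->
  Qfun gamma f b - Qfun gamma f a = \int[mu]_(x in `[a, b]) Phi (f x) - (b - a) * gamma.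
Proof.
move=> cf ab; rewrite -oint0B //; last exact: continuous_Phi_comp.
by rewrite /Qfun; ring.
Qed.

Lemma Qfun_continuous (gamma : R) f : continuous f -> continuous (Qfun gamma f).
Proof.
move=> cf; have cP := continuous_Phi_comp cf.
have lip a b : a <= b -> `|Qfun gamma f b - Qfun gamma f a| <= (1 + `|gamma|) * (b - a).
  move=> ab; rewrite QfunB //.
  have lo := Rintegral_itv_ge cP ab (fun x _ => Phi_ge0 (f x)).
  (* The upper bound [Phi <= 1] is obtained from the lower-bound lemma applied to [- Phi]; together
     the bounds make Q Lipschitz with constant 1 + |gamma|. *)
  have cN : continuous (fun x => - Phi (f x)) by move=> x; apply: cvgN; exact: cP.
  have hi := Rintegral_itv_ge cN ab (fun x _ => _ : -1 <= - Phi (f x)).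
  have {}hi : \int[mu]_(x in `[a, b]) Phi (f x) <= b - a.
    have : -1 * (b - a) <= \int[mu]_(x in `[a, b]) (- Phi (f x)).
      by apply: hi => x; rewrite lerN2 Phi_le1.
    under eq_Rintegral do rewrite -mulN1r.
    by rewrite RintegralZl ?mulN1r ?lerN2 //; exact: continuous_integrable_itv.
  apply: le_trans (ler_normB _ _) _; rewrite (mulrDl 1) mul1r lerD //.
    by rewrite ger0_norm // (le_trans _ lo) ?mul0r.
  by rewrite normrM (ger0_norm (_ : 0 <= b - a)) ?subr_ge0 // mulrC.
have k0 : 0 < 1 + `|gamma| by rewrite ltr_pwDl.
have lip' a b : `|Qfun gamma f b - Qfun gamma f a| <= (1 + `|gamma|) * `|b - a|.
  have [xy|/ltW yx] := leP a b; first by rewrite (ger0_norm (_ : 0 <= b - a)) ?subr_ge0 // lip.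
  by rewrite distrC (distrC b) (ger0_norm (_ : 0 <= a - b)) ?subr_ge0 // lip.
move=> x; apply/cvgrPdist_le => e e0; near=> y.
apply: le_trans (lip' _ _) _; rewrite mulrC -ler_pdivlMr //.
near: y; apply: cvgr_dist_le => //; exact: divr_gt0.
Unshelve. all: by end_near. Qed.

(** The linear term contributes equally to both increments, and strict monotonicity of [Phi]
    compares the integrals. *)
Lemma Qfun_steeper (gamma : R) f g a b : continuous f -> continuous g ->
  (forall x, f x < g x) -> a < b ->
  Qfun gamma f b - Qfun gamma f a < Qfun gamma g b - Qfun gamma g a.
Proof.
move=> cf cg fg ab.
have lt : \int[mu]_(x in `[a, b]) Phi (f x) < \int[mu]_(x in `[a, b]) Phi (g x).
  by apply: Rintegral_itv_lt => //; [exact: continuous_Phi_comp..|move=> x; exact: Phi_lt].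
rewrite [X in X < _](QfunB gamma cf (ltW ab)) [X in _ < X](QfunB gamma cg (ltW ab)).
exact: (ltr_leD lt (lexx _)).
Qed.

End Qfun_facts.

(** * Measurability in the process *)

Section continuous_process.
Context d (S : measurableType d) (R : realType).
Variable V : R -> S -> R.
Hypotheses (mV : forall y, measurable_fun setT (V y)) (cV : forall w, continuous (V^~ w)).

(** Rounding time down to a grid leaves countably many time values, so a preimage is a countable
    union of rectangles. Continuity of the paths then gives joint measurability in the limit of fine
    grids. *)
Lemma measurable_process_floor n :
  measurable_fun setT (fun z : S * R => V ((Num.floor (n.+1%:R * z.2))%:~R / n.+1%:R) z.1).
Proof.
move=> _ B mB; rewrite setTI.
rewrite (_ : _ @^-1` B = \bigcup_(i : int)
    ((V (i%:~R / n.+1%:R) @^-1` B) `*` `[i%:~R / n.+1%:R, (i + 1)%:~R / n.+1%:R[%classic)).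
  apply: countable_bigcupT_measurable => // i; apply: measurableX => //.
  by rewrite -[X in measurable X]setTI; exact: mV.
have N0 : 0 < n.+1%:R :> R by [].
apply/seteqP; split => -[w y] /=.
  move=> VB; exists (Num.floor (n.+1%:R * y)) => //; split => //=.
  have /andP[lo hi] := floor_itv (n.+1%:R * y).
  by rewrite in_itv /= ler_pdivrMr // ltr_pdivlMr // !(mulrC y) lo hi.
move=> [i _ [/= VB]]; rewrite in_itv /= ler_pdivrMr // ltr_pdivlMr // !(mulrC y) => /floor_def ->.
exact: VB.
Qed.

Lemma measurable_process : measurable_fun setT (fun z : S * R => V z.2 z.1).
Proof.
apply: (measurable_fun_cvg measurable_process_floor) => -[w y] _ /=.
apply: (@cvg_comp _ _ _ (fun n => (Num.floor (n.+1%:R * y))%:~R / n.+1%:R : R) (V^~ w)); last exact: cV.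
have N0 n : 0 < n.+1%:R :> R by [].
apply/cvgrPdist_le => e e0.
have /cvgrPdist_le /(_ _ e0) := @cvg_harmonic R.
apply: filterS => n; rewrite /harmonic /= sub0r normrN ger0_norm ?invr_ge0 // => ne.
have /andP[lo hi] := floor_itv (n.+1%:R * y).
rewrite intrD in hi.
apply: le_trans ne; rewrite -[y in `|y - _|](mulfK (lt0r_neq0 (N0 n))) -mulrBl normrM.
rewrite (ger0_norm (_ : 0 <= n.+1%:R^-1)) ?invr_ge0 // ler_piMl ?invr_ge0 //.
by rewrite (mulrC y) ger0_norm ?subr_ge0 // lerBlDl ltW.
Qed.

Lemma measurable_Rintegral_process a b : (forall y w, 0 <= V y w) ->
  measurable_fun setT (fun w => \int[lebesgue_measure]_(y in `[a, b]) V y w).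
Proof.
move=> V0; apply: measurableT_comp => //.
pose K (z : S * R) := (V z.2 z.1 * \1_`[a, b] z.2)%:E.
have mK : measurable_fun setT K.
  apply/measurable_EFinP; apply: measurable_funM; first exact: measurable_process.
  by apply: measurableT_comp => //; exact: measurable_indic.
have K0 z : (0 <= K z)%E by rewrite lee_fin mulr_ge0.
have := @measurable_fun_fubini_tonelli_F _ _ _ _ _ (@lebesgue_measure R) K mK K0.
congr (measurable_fun _ _); apply/funext => w.
rewrite /fubini_F [RHS]integral_mkcond; apply: eq_integral => x _.
by rewrite /K patchE indicE /=; case: (x \in _); rewrite ?mulr1 ?mulr0.
Qed.

End continuous_process.

(** The space [S] is kept arbitrary so that it can later be the sample space carrying only the
    sigma-algebra generated by Y. *)
Lemma measurable_Qfun d (S : measurableType d) (R : realType) (V : R -> S -> R) (gamma t : R) :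
  (forall y, measurable_fun setT (V y)) -> (forall w, continuous (V^~ w)) ->
  measurable_fun setT (fun w => Qfun gamma (V^~ w) t).
Proof.
move=> mV cV; rewrite /Qfun; apply: measurable_funB => //.
have mP y : measurable_fun setT (fun w => Phi (V y w)).
  by apply: measurableT_comp => //; apply: continuous_measurable_fun; exact: Phi_continuous.
have cP w : continuous (fun y => Phi (V y w)) by exact: continuous_Phi_comp.
have P0 y w : 0 <= Phi (V y w) by exact: Phi_ge0.
have mI a b := @measurable_Rintegral_process _ S R (fun y w => Phi (V y w)) mP cP a b P0.
rewrite /oint0; case: (leP 0 t) => _; first exact: mI.
by apply: measurableT_comp => //; exact: mI.
Qed.

(* For continuous q and I, J as in the lemmas below, this is inf_J q < inf_I q, expressed
   through countably many values of q. *)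
Definition inf_lt {R : realType} (J I : set R) (q : R -> R) : Prop :=
  exists r s : rat, [/\ J (ratr s), q (ratr s) < ratr r &
    forall t : rat, I (ratr t) -> ratr r <= q (ratr t)].

Lemma measurable_inf_lt d (S : measurableType d) (R : realType) (J I : set R) (q : S -> R -> R) :
  (forall t, measurable_fun setT (q^~ t)) -> measurable [set w | inf_lt J I (q w)].
Proof.
move=> mq.
have mlt (t : R) (r : rat) : measurable [set w | q w t < ratr r].
  rewrite (_ : [set _ | _] = setT `&` q^~ t @^-1` `]-oo, ratr r[).
    by apply: mq => //; exact: measurable_itv.
  by rewrite setTI; apply/seteqP; split => w /=; rewrite in_itv.
have mif (Q : Prop) (A : set S) : measurable A -> measurable [set w | Q /\ A w].
  move=> mA; have [HQ|HQ] := pselect Q.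
    by rewrite (_ : [set _ | _] = A) //; apply/seteqP; split => w /=; tauto.
  by rewrite (_ : [set _ | _] = set0) //; apply/seteqP; split => w /=; tauto.
rewrite (_ : [set w | _] = \bigcup_(r : rat) \bigcup_(s : rat)
  ([set w | J (ratr s) /\ [set w | q w (ratr s) < ratr r] w] `&`
   ~` \bigcup_(t : rat) [set w | I (ratr t) /\ [set w | q w (ratr t) < ratr r] w])).
  apply: bigcupT_measurable_rat => r; apply: bigcupT_measurable_rat => s.
  apply: measurableI; first exact: mif.
  by apply: measurableC; apply: bigcupT_measurable_rat => t; exact: mif.
apply/seteqP; split => w /=.
  move=> [r [s [Js qs Ir]]]; exists r => //; exists s => //; split => // -[t _ /= [It]].
  by rewrite ltNge Ir.
move=> [r _ [s _ [/= [Js qs] H]]]; exists r, s; split => // t It.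
by rewrite leNgt; apply/negP => qt; apply: H; exists t.
Qed.

(** * Comparison of infima on the two sides of a point for functions of different steepness *)

Section steeper.
Context {R : realType}.
Implicit Types (q : R -> R) (b : R).

Lemma rat_near_lt q b t (r : R) (J : set R) : continuous q -> open J -> J t -> q t < r ->
  exists s : rat, J (ratr s) /\ q (ratr s) < r.
Proof.
move=> cq oJ Jt qt.
have : \forall s \near t, J s /\ q s < r.
  near=> s; split; near: s; first exact: open_nbhs_nbhs.
  by apply: (cvgr_lt (q t)) => //; exact: cq.
move=> /nbhs_ballP[e /= e0 He].
have lt_e : t - e < t + e by lra.
have [s] := rat_in_itvoo lt_e.
rewrite in_itv /= => /andP[s1 s2]; exists s; apply: He.
rewrite /ball /= ltr_norml; apply/andP; split; lra.
Unshelve. all: by end_near. Qed.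

(** The level q'(b) + q(t2) - q(b) separates the two sides: at [t2] the flatter function [q'] lies
    strictly below it, while to the left of [b] it falls below q'(b) by no more than [q] falls below
    q(b), and [q] never goes under q(t2). *)
Lemma inf_lt_of_less_steep q (q' : R -> R) b (t2 : R) : continuous q' ->
  (forall x y, x < y -> q' y - q' x < q y - q x) ->
  (forall s, q t2 <= q s) -> b < t2 -> inf_lt [set s | b < s] [set t | t <= b] q'.
Proof.
move=> cq' steep min2 bt2.
have lt12 : q' t2 < q' b + (q t2 - q b) by have := steep _ _ bt2; lra.
have [r] := rat_in_itvoo lt12; rewrite in_itv /= => /andP[r1 r2].
have [s [bs qs]] := @rat_near_lt q' b t2 (ratr r) [set s | b < s] cq' (@open_gt _ b) bt2 r1.
exists r, s; split => // t /= tb.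
have : q' b - q' (ratr t) <= q b - q (ratr t).
  by move: tb; rewrite le_eqVlt => /predU1P[->|/steep/ltW//]; rewrite !subrr.
have := min2 (ratr t); lra.
Qed.

(** Mirror image, with separating level q'(b) + q(t1) - q(b): the steeper [q'] is strictly below it
    at [t1] and above it everywhere to the right of [b]. *)
Lemma inf_lt_of_steeper q (q' : R -> R) b (t1 : R) : continuous q' ->
  (forall x y, x < y -> q y - q x < q' y - q' x) ->
  (forall s, q t1 <= q s) -> t1 < b -> inf_lt [set t | t <= b] [set s | b < s] q'.
Proof.
move=> cq' steep min1 t1b.
have lt12 : q' t1 < q' b + (q t1 - q b) by have := steep _ _ t1b; lra.
have [r] := rat_in_itvoo lt12; rewrite in_itv /= => /andP[r1 r2].
have [s [bs qs]] := @rat_near_lt q' b t1 (ratr r) [set s | s < b] cq' (@open_lt _ b) t1b r1.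
exists r, s; split => //=; first exact: ltW.
move=> t /steep st; have := min1 (ratr t); lra.
Qed.

(** The two witnesses conflict: [q] increases from the left one to the right one, whereas [q'], at
    least as steep, would decrease. This monotonicity is what later makes the events [H k]
    disjoint. *)
Lemma inf_lt_steeper_asym q (q' : R -> R) b : (forall x y, x < y -> q y - q x <= q' y - q' x) ->
  inf_lt [set t | t <= b] [set s | b < s] q -> ~ inf_lt [set s | b < s] [set t | t <= b] q'.
Proof.
move=> steep [r [t [/= tb qt Hs]]] [r' [s [/= bs qs Ht]]].
have := steep _ _ (le_lt_trans tb bs); have := Hs _ bs; have := Ht _ tb; lra.
Qed.

End steeper.

(** * Almost sure uniqueness of the argmin *)

Lemma negligible_small d (T : measurableType d) (R : realType) (P : {measure set T -> \bar R})
    (E : set T) :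
  (forall e : R, 0 < e -> exists U, [/\ measurable U, E `<=` U & (P U <= e%:E)%E]) ->
  P.-negligible E.
Proof.
move=> H; have e0 n : 0 < n.+1%:R^-1 :> R by [].
pose U n := sval (cid (H _ (e0 n))).
have UP n := svalP (cid (H _ (e0 n))); rewrite -/(U _) in UP.
have mU n : measurable (U n) by have [] := UP n.
exists (\bigcap_n U n); split; first exact: bigcapT_measurable.
  apply/eqP; rewrite eq_le measure_ge0 andbT; apply/lee_addgt0Pr => e e1; rewrite add0e.
  have /cvgrPdist_le /(_ _ e1) [n _ /(_ n (leqnn n))] := @cvg_harmonic R.
  rewrite /harmonic /= sub0r normrN ger0_norm // => ne.
  apply: (@le_trans _ _ (P (U n))).
    by apply: le_measure; rewrite ?inE //; [exact: bigcapT_measurable|exact: bigcap_inf].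
  by have [_ _ Un] := UP n; apply: le_trans Un _; rewrite lee_fin.
by move=> w Ew n _; have [_ EU _] := UP n; exact: EU.
Qed.

Lemma negligible_countable_bigcup d (T : measurableType d) (R : realType)
    (P : {measure set T -> \bar R}) (I : countType) (F : I -> set T) :
  (forall i, P.-negligible (F i)) -> P.-negligible (\bigcup_i F i).
Proof.
move=> HF; apply: (@negligibleS _ _ _ _ (\bigcup_n if unpickle n is Some i then F i else set0)).
  by move=> w [i _ Fw]; exists (pickle i) => //; rewrite pickleK.
apply: negligible_bigcup => n; case: (unpickle n) => [i|]; [exact: HF|exact: negligible_set0].
Qed.

Section unique_argmin.
Context d (T : measurableType d) (R : realType) (P : probability T R).
Variables (Z : T -> R) (Y : R -> T -> R) (m h : R -> R) (gamma C : R).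
Hypotheses (mZ : measurable_fun setT Z) (mY : forall t, measurable_fun setT (Y t)).
Hypothesis indep : forall A H, measurable A -> <<s cylinder Y >> H ->
  P (Z @^-1` A `&` H) = (P (Z @^-1` A) * P H)%E.
Hypothesis C0 : 0 < C.
Hypothesis Zsmall : forall a b, a <= b -> (P (Z @^-1` `]a, b]) <= (C * (b - a))%:E)%E.
Hypotheses (cY : forall w, continuous (Y^~ w)) (cm : continuous m) (ch : continuous h).
Hypothesis h0 : forall t, 0 < h t.

(** Here [z] is a free parameter, so [path z w] depends on [w] only through [Y]. The actual process
    corresponds to [z = Z w]. *)
Let path z w y := m y + h y * z + Y y w.
Let q z w := Qfun gamma (path z w).

Let cpath z w : continuous (path z w).
Proof.
move=> y; apply: cvgD; last exact: cY.
by apply: cvgD; [exact: cm|apply: cvgM; [exact: ch|exact: cvg_cst]].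
Qed.

Let cq z w : continuous (q z w). Proof. exact/Qfun_continuous/cpath. Qed.

Let steep z z' w x y : z < z' -> x < y -> q z w y - q z w x < q z' w y - q z' w x.
Proof.
move=> zz' xy; apply: Qfun_steeper => //; [exact: cpath..|].
by move=> u; rewrite /path ltrD2r ltrD2l ltr_pM2l.
Qed.

Let sub_sigma : <<s cylinder Y >> `<=` measurable.
Proof.
apply: smallest_sub; first exact: sigma_algebra_measurable.
by move=> K; exact: cylinder_measurable.
Qed.

Let mpre (A : set R) : measurable A -> measurable (Z @^-1` A).
Proof. by move=> mA; rewrite -[X in measurable X]setTI; exact: mZ. Qed.

(** The measurability lemmas are instantiated on the sample space equipped with the sigma-algebra
    generated by the cylinders, since independence is available only for its events. *)
Let sigma_inf_lt J I z : <<s cylinder Y >> [set w | inf_lt J I (q z w)].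
Proof.
pose S := g_sigma_algebraType (cylinder Y).
apply: (@measurable_inf_lt _ S R J I (fun w => q z w)) => t.
apply: (@measurable_Qfun _ S R (fun y w => path z w y)); last exact: cpath.
move=> y; apply: measurable_funD => //.
move=> _ B mB; apply: sub_sigma_algebra; rewrite setIC.
by apply: cylinderI => //; exact: cylinderT.
Qed.

Let Zpoint x : P (Z @^-1` [set x]) = 0.
Proof.
apply/eqP; rewrite eq_le measure_ge0 andbT; apply/lee_addgt0Pr => e e0; rewrite add0e.
have eC : 0 < e / C by rewrite divr_gt0.
apply: (@le_trans _ _ (P (Z @^-1` `]x - e / C, x]))).
  apply: le_measure; rewrite ?inE; [exact/mpre|exact: (mpre (measurable_itv _))|].
  by move=> w /= ->; rewrite in_itv /= lexx andbT ltrBlDr ltrDl.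
have xe : x - e / C <= x by rewrite lerBlDr lerDl ltW.
apply: (le_trans (Zsmall xe)).
by rewrite opprB addrC subrK mulrC divfK // gt_eqF.
Qed.

(** The lower bound on [Z] gives the grid a first point, so its cells are indexed by natural
    numbers. *)
Let bad b (M : nat) := [set w | exists t1 t2, [/\ t1 < b, b < t2,
  argmin (q (Z w) w) t1, argmin (q (Z w) w) t2 & - M%:R <= Z w]].

Let negligible_bad b M : P.-negligible (bad b M).
Proof.
apply: negligible_small => e e0.
(* By [Zsmall], a cell of this length has probability at most [e] under the law of [Z]. *)
pose dl := e / C; have dl0 : 0 < dl by rewrite divr_gt0.
pose x (k : nat) := - M%:R + k%:R * dl.
have xS k : x k.+1 = x k + dl by rewrite /x -natr1 mulrDl mul1r addrA.
(* Below the critical value the right-hand infimum is the smaller one ([L]), above it the left-hand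
   one ([G]). Thus [H k] places the critical value between the end points of the k-th cell. *)
pose L z := [set w | inf_lt [set s | b < s] [set t | t <= b] (q z w)].
pose G z := [set w | inf_lt [set t | t <= b] [set s | b < s] (q z w)].
pose H k := L (x k) `&` G (x k.+1).
have sH k : <<s cylinder Y >> (H k).
  exact: (@measurableI _ (g_sigma_algebraType (cylinder Y)) _ _ (sigma_inf_lt _ _ _) (sigma_inf_lt _ _ _)).
have mH k := sub_sigma (sH k).
have asym z z' w : z <= z' -> G z w -> ~ L z' w.
  move=> zz' Gw; apply: inf_lt_steeper_asym Gw => u y uy.
  move: zz'; rewrite le_eqVlt => /predU1P[->|zz']; first exact: lexx.
  exact: (ltW (steep w zz' uy)).
have xmono k k' : (k <= k')%N -> x k <= x k'.
  by move=> kk'; rewrite lerD2l ler_pM2r // ler_nat.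
have tH : trivIset setT H.
  (* For k < k' the upper end of the first cell is at most the lower end of the second, so [G] at
     the former excludes [L] at the latter. *)
  apply/trivIsetP => k k' _ _ kk'; apply/seteqP; split => // w [[Lk Gk] [Lk' Gk']].
  have [lt|lt|E] := ltngtP k k'; last by rewrite E eqxx in kk'.
    exact: (asym _ _ _ (xmono _ _ lt) Gk Lk').
  exact: (asym _ _ _ (xmono _ _ lt) Gk' Lk).
pose D k := Z @^-1` `]x k, x k.+1[.
have mD k : measurable (D k) by exact: (mpre (measurable_itv _)).
have mDH k : measurable (D k `&` H k) by exact: measurableI.
exists (\bigcup_k (D k `&` H k) `|` \bigcup_k (Z @^-1` [set x k])); split.
- by apply: measurableU; apply: bigcupT_measurable => // k; exact: mpre.
- move=> w [t1 [t2 [t1b bt2 a1 a2 ZM]]].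
  pose k := Num.truncn ((Z w + M%:R) / dl).
  have /truncn_itv/andP[] : 0 <= (Z w + M%:R) / dl.
    by apply: divr_ge0; [rewrite -lerBlDr sub0r|exact: ltW].
  rewrite -/k ler_pdivlMr // ltr_pdivrMr // => lo hi.
  have xk : x k <= Z w by rewrite /x addrC lerBlDr.
  have xk1 : Z w < x k.+1 by rewrite /x addrC ltrBrDr.
  (* Strict comparison of steepness needs [Z w] strictly above [x k]; equality is put into the null
     set of grid points. *)
  move: xk; rewrite le_eqVlt => /predU1P[xk|xk]; first by right; exists k.
  left; exists k => //; split; first by rewrite /D /= in_itv /= xk xk1.
  split.
    apply: (@inf_lt_of_less_steep R (q (Z w) w) _ b t2) => //.
    by move=> u y; exact: steep.
  apply: (@inf_lt_of_steeper R (q (Z w) w) _ b t1) => //.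
  by move=> u y; exact: steep.
- apply: le_trans (measureU2 _ _ _) _.
  + exact: bigcupT_measurable.
  + by apply: bigcupT_measurable => k; exact: mpre.
  rewrite [X in (_ + X)%E](_ : _ = 0%E) ?adde0; last first.
    apply: measure_negligible; first by apply: bigcupT_measurable => k; exact: mpre.
    by apply: negligible_bigcup => k; apply/negligibleP; [exact: mpre|exact: Zpoint].
  suff : (P (\bigcup_k (D k `&` H k)) <= e%:E)%E by [].
  have -> : (P (\bigcup_k (D k `&` H k)) = \sum_(k <oo) P (D k `&` H k))%E.
    by apply: measure_semi_bigcup => //; [exact: trivIset_setIl|exact: bigcupT_measurable].
  apply: (@le_trans _ _ (\sum_(k <oo) (e%:E * P (H k)))%E).
    apply: lee_nneseries => k; first by move=> _ _; exact: measure_ge0.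
    move=> _; rewrite (indep (measurable_itv _) (sH k)).
    apply: lee_wpmul2r; first exact: measure_ge0.
    apply: (@le_trans _ _ (P (Z @^-1` `]x k, x k.+1]))).
      apply: le_measure; rewrite ?inE; [exact: mD|exact: (mpre (measurable_itv _))|].
      by move=> w; rewrite /D /= !in_itv /= => /andP[-> /ltW].
    apply: (le_trans (Zsmall (xmono _ _ (leqnSn k)))).
    by rewrite xS addrAC subrr add0r mulrC divfK // gt_eqF.
  rewrite nneseriesZl; last by move=> k _; exact: measure_ge0.
  rewrite -(@measure_semi_bigcup _ _ _ P H) //; last exact: bigcupT_measurable.
  rewrite -[leRHS]mule1; apply: lee_wpmul2l; first by rewrite lee_fin ltW.
  by apply: probability_le1; exact: bigcupT_measurable.
Qed.

Lemma negligible_two_argmins : P.-negligible [set w | exists t1 t2,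
  [/\ t1 < t2, argmin (q (Z w) w) t1 & argmin (q (Z w) w) t2]].
Proof.
apply: (@negligibleS _ _ _ _ (\bigcup_(b : rat) \bigcup_M bad (ratr b) M)).
  move=> w [t1 [t2 [t12 a1 a2]]].
  have [b] := rat_in_itvoo t12; rewrite in_itv /= => /andP[b1 b2].
  exists b => //; exists (Num.truncn `|Z w|).+1 => //; exists t1, t2; split => //.
  have := ler_norm (- Z w); have /truncn_itv/andP[_] := normr_ge0 (Z w).
  rewrite normrN => lt ge; rewrite lerNl; exact: le_trans ge (ltW lt).
by apply: negligible_countable_bigcup => b; apply: negligible_bigcup => M.
Qed.

End unique_argmin.

(** * Gaussian regression on the value at time 0 *)

Lemma sum_nth_pair (R : realType) (l : seq (R * R)) (G : R -> R -> R) :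
  \sum_(i < size l) G (nth 0 (map fst l) i) (nth 0 (map snd l) i) = \sum_(p <- l) G p.1 p.2.
Proof.
rewrite (big_nth (0, 0)) big_mkord; apply: eq_bigr => i _.
by rewrite !(nth_map (0, 0)).
Qed.

Section gaussian_decomposition.
Context d (T : measurableType d) (R : realType) (P : probability T R).
Variables (W : R -> T -> R) (m : R -> R) (Sig : R -> R -> R).
Hypothesis gW : gaussian_process P W m Sig.
Hypothesis Sig0 : 0 < Sig 0 0.

(* Symmetrized, since a quadratic form only sees the symmetric part of Sig. *)
Definition regression (t : R) : R := (Sig t 0 + Sig 0 t) / (2 * Sig 0 0).

Definition centered t w : R := W t w - m t.
(** The regression coefficient makes the symmetrized covariance with [centered 0] vanish. *)
Definition residual t w : R := centered t w - regression t * centered 0 w.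

(** The variance of [lincomb residual l]: the part along [centered 0] is uncorrelated with the
    residuals, so its variance is subtracted as in Pythagoras' theorem. *)
Definition residual_variance (l : seq (R * R)) : R :=
  \sum_(p <- l) \sum_(r <- l) p.1 * r.1 * Sig p.2 r.2 -
  Sig 0 0 * (\sum_(p <- l) p.1 * regression p.2) ^+ 2.

(** The argument of the cosine is a centred linear combination of values of W, with coefficient a -
    beta at time 0. Its variance splits without a cross term, so the Gaussian exponential
    factorizes. *)
Lemma residual_joint_cos a l c :
  \int[P]_w cos (a * centered 0 w + lincomb residual l w + c) =
  cos c * expR (- (Sig 0 0 * a ^+ 2 / 2)) * expR (- (residual_variance l / 2)).
Proof.
have [mW law] := gW.
pose beta := \sum_(p <- l) p.1 * regression p.2.
pose ts (i : 'I_(size l).+1) : R := nth 0 (0 :: map snd l) i.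
pose b (i : 'I_(size l).+1) : R := nth 0 ((a - beta) :: map fst l) i.
pose X w := \sum_(i < (size l).+1) b i * W (ts i) w.
pose mu := \sum_(i < (size l).+1) b i * m (ts i).
pose V := \sum_(i < (size l).+1) \sum_(j < (size l).+1) b i * b j * Sig (ts i) (ts j).
have sumE (F : R -> R) : \sum_(i < (size l).+1) b i * F (ts i) =
    (a - beta) * F 0 + \sum_(p <- l) p.1 * F p.2.
  by rewrite big_ord_recl /= (sum_nth_pair l (fun x y => x * F y)).
have VE : V = Sig 0 0 * a ^+ 2 + residual_variance l.
  have -> : V = \sum_(i < (size l).+1) b i *
      ((a - beta) * Sig (ts i) 0 + \sum_(r <- l) r.1 * Sig (ts i) r.2).
    apply: eq_bigr => i _; rewrite -(sumE (Sig (ts i))) mulr_sumr.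
    by apply: eq_bigr => j _; rewrite mulrA.
  rewrite (sumE (fun t => (a - beta) * Sig t 0 + \sum_(r <- l) r.1 * Sig t r.2)).
  rewrite /residual_variance -/beta.
  have -> : \sum_(p <- l) p.1 * ((a - beta) * Sig p.2 0 + \sum_(r <- l) r.1 * Sig p.2 r.2) =
      (a - beta) * (\sum_(p <- l) p.1 * Sig p.2 0) +
      \sum_(p <- l) \sum_(r <- l) p.1 * r.1 * Sig p.2 r.2.
    rewrite mulr_sumr -big_split; apply: eq_bigr => p _ /=.
    rewrite mulrDr mulrCA; congr (_ + _); rewrite mulr_sumr.
    by apply: eq_bigr => r _; rewrite mulrA.
  (* The choice of regression coefficient enters here and cancels the terms linear in [a]. *)
  have -> : \sum_(p <- l) p.1 * Sig p.2 0 = 2 * Sig 0 0 * beta - \sum_(r <- l) r.1 * Sig 0 r.2.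
    rewrite /beta mulr_sumr -sumrB; apply: eq_bigr => p _; rewrite /regression.
    by field; rewrite gt_eqF.
  ring.
have V0 : 0 <= V by exact: gaussian_process_variance_ge0 gW.
have mX : measurable_fun setT X.
  by apply: measurable_sum => i; apply: measurable_funM.
have XE w : a * centered 0 w + lincomb residual l w + c = X w - mu + c.
  congr (_ + c); rewrite /X /mu (sumE (fun t => W t w)) (sumE m) /lincomb.
  have -> : \sum_(p <- l) p.1 * residual p.2 w =
      \sum_(p <- l) p.1 * W p.2 w - \sum_(p <- l) p.1 * m p.2 - beta * centered 0 w.
    rewrite /beta mulr_suml -!sumrB; apply: eq_bigr => p _.
    by rewrite /residual /centered; ring.
  by rewrite /centered; ring.
under eq_Rintegral do rewrite XE.
rewrite (gaussian_law_cos c mX V0 (law _ ts b)) VE -mulrA -expRD; congr (_ * expR _).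
by field.
Qed.

Lemma centered_itv_le a b : a <= b ->
  (P (centered 0 @^-1` `]a, b]) <= (normal_peak (Num.sqrt (Sig 0 0)) * (b - a))%:E)%E.
Proof.
move=> ab; have [mW law] := gW.
have := law 1%N (fun=> 0) (fun=> 1) `]a + m 0, b + m 0]%classic (measurable_itv _).
rewrite !big_ord1 !mul1r /gaussian_law gt_eqF // => lawE.
have s0 : Num.sqrt (Sig 0 0) != 0 by rewrite gt_eqF // sqrtr_gt0.
have ab' : a + m 0 <= b + m 0 by rewrite lerD2r.
have := normal_prob_itv_le (m 0) s0 ab'.
rewrite opprD addrACA subrr addr0 -lee_fin fineK ?normal_prob_fin_num // -lawE.
congr (P _ <= _)%E; apply/seteqP; split => w /=; rewrite big_ord1 mul1r !in_itv /= /centered.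
  by rewrite ltrBrDr lerBlDr.
by rewrite ltrBrDr lerBlDr.
Qed.

End gaussian_decomposition.

Theorem theorem3 (R : realType) (d : measure_display) (T : measurableType d)
  (P : probability T R) (W : R -> T -> R) (m : R -> R) (Sig : R -> R -> R)
  (gamma : R) :
  gaussian_process P W m Sig ->
  {ae P, forall w, continuous (fun t => W t w)} ->
  continuous m ->
  continuous (fun p : R * R => Sig p.1 p.2) ->
  (forall s t, 0 < Sig t s) ->
  {ae P, forall w, forall t1 t2,
     argmin (Qfun gamma (fun y => W y w)) t1 ->
     argmin (Qfun gamma (fun y => W y w)) t2 -> t1 = t2}.
Proof.
move=> gW [N [mN N0 cWN]] cm cSig Sig_gt0; have Sig0 := Sig_gt0 0 0.
have mW : forall t, measurable_fun setT (W t) by case: gW.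
(* Multiplication by this indicator freezes the paths at 0 on the exceptional set, so that [Y] is
   continuous for every sample point. *)
pose g : T -> R := \1_(~` N).
have g0 w : N w -> g w = 0 by move=> Nw; rewrite /g indicE memNset //=; exact.
have g1 w : ~ N w -> g w = 1 by move=> Nw; rewrite /g indicE mem_set.
have mg : measurable_fun setT g by apply: measurable_indic; exact: measurableC.
pose h := regression Sig.
pose Z w := g w * centered W m 0 w.
pose Y t w := g w * residual W m Sig t w.
have mC t : measurable_fun setT (centered W m t) by exact: measurable_funB.
have mY t : measurable_fun setT (Y t).
  by apply: measurable_funM => //; apply: measurable_funB => //; exact: measurable_funM.
have mZ : measurable_fun setT Z by exact: measurable_funM.
(* Positivity of the covariance makes every path value strictly increasing in [Z]. *)
have h_gt0 t : 0 < h t by rewrite divr_gt0 ?addr_gt0 ?mulr_gt0.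
have ch : continuous h.
  have cS (f1 f2 : R -> R) : continuous f1 -> continuous f2 -> continuous (fun t => Sig (f1 t) (f2 t)).
    move=> c1 c2 t; apply: (@cvg_comp _ _ _ (fun t => (f1 t, f2 t)) (fun p => Sig p.1 p.2)); last exact: (cSig (f1 t, f2 t)).
    exact: (cvg_pair (c1 t) (c2 t)).
  have cid : continuous (fun t : R => t) by move=> t; exact: cvg_id.
  have c0 : continuous (fun t : R => 0 : R) by move=> t; exact: cvg_cst.
  move=> t; apply: cvgM; last exact: cvg_cst.
  by apply: cvgD; [exact: (cS _ _ cid c0)|exact: (cS _ _ c0 cid)].
have cW w : ~ N w -> continuous (fun t => W t w).
  by move=> Nw; apply: contrapT => nc; apply: Nw; exact: cWN.
have cY w : continuous (Y^~ w).
  have [Nw|Nw] := pselect (N w).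
    by rewrite /Y (_ : (fun t => _) = cst 0); [move=> t; exact: cvg_cst|apply/funext => t; rewrite g0 // mul0r].
  move=> t; apply: cvgM; first exact: cvg_cst.
  apply: cvgB; first by apply: cvgB; [exact: cW|exact: cm].
  by apply: cvgM; [exact: ch|exact: cvg_cst].
(* The modified variables agree with the original ones off the null set [N], so the cosine integrals
   are unchanged. *)
have jc a l c : \int[P]_w cos (a * Z w + lincomb Y l w + c) =
    cos c * expR (- (Sig 0 0 * a ^+ 2 / 2)) * expR (- (residual_variance Sig l / 2)).
  rewrite -(residual_joint_cos gW Sig0); congr fine.
  have mL (X : T -> R) (Y' : R -> T -> R) : measurable_fun setT X -> (forall t, measurable_fun setT (Y' t)) ->
      measurable_fun setT (fun w => (cos (a * X w + lincomb Y' l w + c))%:E).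
    move=> mX mY'; apply/measurable_EFinP; apply: measurable_cos_comp.
    by apply: measurable_funD; [exact: measurable_funM|exact: measurable_lincomb].
  apply: ae_eq_integral => //; [exact: mL|apply: mL => // t|].
    by apply: measurable_funB => //; exact: measurable_funM.
  exists N; split => // w; apply: contra_notP => Nw _.
  rewrite /Z g1 // mul1r /lincomb; congr ((cos (_ + _ + _))%:E).
  by apply: eq_bigr => p _; rewrite /Y g1 // mul1r.
have k0 : expR (- (Sig 0 0 * 0 ^+ 2 / 2)) = 1 :> R by rewrite expr0n mulr0 mul0r oppr0 expR0.
have kN a : expR (- (Sig 0 0 * (- a) ^+ 2 / 2)) = expR (- (Sig 0 0 * a ^+ 2 / 2)) by rewrite sqrrN.
have psi0 : expR (- (residual_variance Sig [::] / 2)) = 1 :> R.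
  by rewrite /residual_variance !big_nil expr0n mulr0 subr0 mul0r oppr0 expR0.
have indep A H mA sH := @independent_sigma_cylinder _ T R P R Z Y mZ mY
  (fun a => expR (- (Sig 0 0 * a ^+ 2 / 2))) (fun l => expR (- (residual_variance Sig l / 2)))
  k0 kN psi0 jc A mA H sH.
have C0 : 0 < normal_peak (Num.sqrt (Sig 0 0)) by rewrite normal_peak_gt0 // gt_eqF // sqrtr_gt0.
have Zs a b : a <= b -> (P (Z @^-1` `]a, b]) <= (normal_peak (Num.sqrt (Sig 0 0)) * (b - a))%:E)%E.
  move=> ab; apply: le_trans (centered_itv_le gW Sig0 ab).
  have mpre (X : T -> R) : measurable_fun setT X -> measurable (X @^-1` `]a, b]).
    by move=> mX; rewrite -[X in measurable X]setTI; apply: mX => //; exact: measurable_itv.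
  apply: (@le_trans _ _ (P (centered W m 0 @^-1` `]a, b] `|` N))).
    apply: le_measure; rewrite ?inE; [exact: mpre|by apply: measurableU => //; exact: mpre|].
    move=> w /=; have [Nw|Nw] := pselect (N w); first by right.
    by rewrite /Z g1 // mul1r; left.
  apply: le_trans (measureU2 _ _ _) _ => //; first exact: mpre.
  by rewrite [X in (_ + X)%E]N0 adde0.
have := negligible_two_argmins (m := m) gamma mZ mY indep C0 Zs cY cm ch h_gt0.
move=> /(negligibleU (ex_intro _ N (And3 mN N0 (@subset_refl _ N)))).
apply: negligibleS => w /= nuniq; have [Nw|Nw] := pselect (N w); first by left.
right; move: nuniq.
have -> : (fun y => W y w) = (fun y => m y + h y * Z w + Y y w).
  by apply/funext => y; rewrite /Y /Z g1 // !mul1r /residual -/h /centered; ring.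
move=> nuniq; apply: contrapT => H; apply: nuniq => t1 t2 a1 a2.
have [lt|lt|//] := ltgtP t1 t2.
  by exfalso; apply: H; exists t1, t2.
by exfalso; apply: H; exists t2, t1.
Qed.
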